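(* Let $f(z)=\sum_{k\ge0}a_kz^k$ be an analytic function that is not a polynomial, with radius of convergence $R\in(0,\infty]$, and let $a_{n_0}$ be its first nonzero coefficient. Then the optimal radii $r_*(n)$ satisfy $r_*(n)\le r_*(n+1)$ for all $n>n_0$, and $\lim_{n\to\infty}r_*(n)=R$. Furthermore: if $r_*(n)=R$ then $R<\infty$, $\|f\|_{H^1(D_R)}<\infty$ and $\nu<\infty$; and if $R<\infty$, $\|f\|_{H^1(D_R)}<\infty$ and $\nu<n$, then $r_*(n)=R$.
   Context: $M_1(r)=\frac{1}{2\pi}\int_0^{2\pi}|f(re^{i\theta})|\,d\theta$ for $0<r<R$; if $R<\infty$ set $M_1(R)=\|f\|_{H^1(D_R)}=\lim_{r\to R}M_1(r)\in(0,\infty]$. For $n>n_0$ the optimal radius $r_*(n)$ is the smallest minimizer of $r\mapsto r^{-n}M_1(r)$ over $0<r\le R$ (over $0<r<\infty$ if $R=\infty$); such minimizers exist. With $\sigma(r)=\log M_1(r)$, $\nu=\sup_{0<r<R}r\sigma'(r)=\lim_{r\to R}r\sigma'(r)\in(0,\infty]$. *)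

(* Defs.v *)
From Stdlib Require Import Reals ClassicalEpsilon.
From Coquelicot Require Import Coquelicot.
Open Scope R_scope.

Definition fval (a : nat -> C) (z : C) : C :=
  (Series (fun k => Re (Cmult (a k) (Cpow z k))),
   Series (fun k => Im (Cmult (a k) (Cpow z k)))).

Definition radius (a : nat -> C) : Rbar := CV_radius (fun k => Cmod (a k)).

Definition M1 (a : nat -> C) (r : R) : R :=
  / (2 * PI) * RInt (fun t => Cmod (fval a (r * cos t, r * sin t))) 0 (2 * PI).

(* M_1(R) = ||f||_{H^1(D_R)} = lim_{r -> R^-} M_1(r) in (0, +oo]
   (only meaningful when R is finite; junk value +oo otherwise). *)
Definition M1R (a : nat -> C) : Rbar :=
  match radius a with
  | Finite Rf =>
      epsilon (inhabits p_infty)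
        (fun L => filterlim (M1 a) (at_left Rf) (Rbar_locally L))
  | _ => p_infty
  end.

Definition obj (a : nat -> C) (n : nat) (r : R) : Rbar :=
  if Rbar_lt_dec r (radius a) then Finite (M1 a r / r ^ n)
  else Rbar_mult (/ r ^ n) (M1R a).

Definition is_opt_radius (a : nat -> C) (n : nat) (r : R) : Prop :=
  0 < r /\ Rbar_le r (radius a) /\
  (forall s, 0 < s -> Rbar_le s (radius a) -> Rbar_le (obj a n r) (obj a n s)) /\
  (forall s, 0 < s -> Rbar_le s (radius a) -> obj a n s = obj a n r -> r <= s).

Definition rstar (a : nat -> C) (n : nat) : R :=
  epsilon (inhabits 0) (is_opt_radius a n).

Definition nu (a : nat -> C) : Rbar :=
  Lub_Rbar (fun x => exists r, 0 < r /\ Rbar_lt r (radius a) /\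
                              x = r * Derive (fun t => ln (M1 a t)) r).

(* Main.v *)
Require Import Defs.
From Stdlib Require Import Reals Lra Lia ClassicalEpsilon.
From Coquelicot Require Import Coquelicot.
Open Scope R_scope.

(** By Hardy's theorem [ln (M1 r)] is a convex function of [ln r]. For a polynomial [p] and a
    weight [g] with [|g| <= 1], [F z = int p(z e^(it)) g(t) dt / (2 pi)] is a polynomial bounded
    by [M1 |z|], with near equality at [r] for [g = conj p / (|p| + eps)] on the circle of
    radius [r]; so Hardy's theorem follows from the three circles theorem for [F]. That in
    turn follows by applying the coefficient bound [|d_k| rho^k <= max |F|^N] on two circles
    to [F^N] and letting [N] tend to infinity. Power series are limits of their partial sums.

    Minimizers exist since [M1] is continuous by convexity and [M1 r >= |a_k| r^k] makes
    [r^(-n) M1 r] coercive; comparing minimality for [n] and for [n + 1] gives monotonicity.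
    The minimum sits at [R] according to whether the slopes of the convex function
    [ln (M1 r)] of [ln r], whose supremum is [nu], stay below [n]. *)

(** * Polynomials on circles and the coefficient bound *)

(** A mean of moduli is not the modulus of an analytic function, so a three circles argument does
    not apply to [M1] itself. The weight [g] depends on the angle only: one polynomial F is
    therefore controlled on all circles at once. Working with partial sums keeps F a finite sum of
    moments of [g]. The coefficient bound is the same pairing, with g = e^(-ikt). Adding it up over
    the terms of a polynomial loses a factor equal to their number; for F^N this number grows only
    linearly in N while the bounds grow geometrically, so the loss disappears. [M1R] is a chosen
    limit and [Derive] a total function, so the existence of the limit must be proved and the
    derivative must be tied to difference quotients. Convexity does both: it makes [M1] monotone
    near the boundary and traps [r * Derive] between slopes of chords. A chord of slope q from x to
    y means M1 y = M1 x (y/x)^q, and this growth is what competes with (y/x)^n at the boundary. *)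

Definition cis (t : R) : C := (cos t, sin t).

Definition peval (a : nat -> C) (m : nat) (z : C) : C :=
  sum_n (fun k => a k * z ^ k)%C m.

Lemma circle_cis (r t : R) : (r * cos t, r * sin t) = (r * cis t)%C.
Proof. unfold cis, Cmult; simpl; f_equal; ring. Qed.

Lemma cis_plus (x y : R) : cis (x + y) = (cis x * cis y)%C.
Proof. unfold cis, Cmult; simpl; rewrite cos_plus, sin_plus; f_equal; ring. Qed.

Lemma cis_0 : cis 0 = 1%C.
Proof. unfold cis; rewrite cos_0, sin_0; reflexivity. Qed.

Lemma Cmod_cis (t : R) : Cmod (cis t) = 1.
Proof.
  unfold Cmod, cis; simpl fst; simpl snd.
  replace (cos t ^ 2 + sin t ^ 2) with 1; [apply sqrt_1|].
  generalize (sin2_cos2 t); unfold Rsqr; intros; lra.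
Qed.

Lemma cis_pow (t : R) (k : nat) : (cis t ^ k)%C = cis (INR k * t).
Proof.
  induction k as [|k IH].
  - simpl INR; rewrite Rmult_0_l, cis_0; reflexivity.
  - rewrite Cpow_S, IH, S_INR, <- cis_plus; f_equal; ring.
Qed.

Lemma Cmod_Rcis (r t : R) : 0 <= r -> Cmod (r * cis t)%C = r.
Proof.
  intros Hr; rewrite Cmod_mult, Cmod_cis, Cmod_R, Rabs_pos_eq; lra.
Qed.

Lemma peval_S (a : nat -> C) (m : nat) (z : C) :
  peval a (S m) z = (peval a m z + a (S m) * z ^ S m)%C.
Proof. unfold peval; rewrite sum_Sn; reflexivity. Qed.

Lemma peval_0 (a : nat -> C) (z : C) : peval a 0 z = a 0%nat.
Proof.
  unfold peval; rewrite sum_O. change (z ^ 0)%C with (RtoC 1). ring.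
Qed.

Lemma Cmod_peval_le (a : nat -> C) (m : nat) (z : C) :
  Cmod (peval a m z) <= sum_n (fun k => Cmod (a k) * Cmod z ^ k) m.
Proof.
  induction m as [|m IH].
  - rewrite peval_0, sum_O; simpl; lra.
  - rewrite peval_S, sum_Sn; eapply Rle_trans; [apply Cmod_triangle|].
    rewrite Cmod_mult, Cmod_pow; apply Rplus_le_compat; [exact IH | apply Rle_refl].
Qed.

(** * Continuity of complex-valued maps *)

Section Continuity.
Context {U : UniformSpace}.

Lemma continuous_pair (f g : U -> R) (x : U) :
  continuous f x -> continuous g x -> continuous (fun u => (f u, g u) : C) x.
Proof.
  intros Hf Hg.
  apply (continuous_comp_2 f g (fun p q => (p, q) : C)); auto.
  apply (continuous_ext (fun w : R * R => w)); [intros []; reflexivity | apply continuous_id].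
Qed.

Lemma continuous_Re (f : U -> C) (x : U) :
  continuous f x -> continuous (fun u => Re (f u)) x.
Proof.
  intros Hf; apply (continuous_comp f Re); [exact Hf|].
  destruct (f x); apply (continuous_fst (U := R_UniformSpace) (V := R_UniformSpace)).
Qed.

Lemma continuous_Im (f : U -> C) (x : U) :
  continuous f x -> continuous (fun u => Im (f u)) x.
Proof.
  intros Hf; apply (continuous_comp f Im); [exact Hf|].
  destruct (f x); apply (continuous_snd (U := R_UniformSpace) (V := R_UniformSpace)).
Qed.

Lemma continuous_Cmult (f g : U -> C) (x : U) :
  continuous f x -> continuous g x -> continuous (fun u => f u * g u)%C x.
Proof.
  intros Hf Hg; unfold Cmult; apply continuous_pair.
  - apply @continuous_minus; apply @continuous_mult;
      (apply continuous_Re || apply continuous_Im); auto.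
  - apply @continuous_plus; apply @continuous_mult;
      (apply continuous_Re || apply continuous_Im); auto.
Qed.

Lemma continuous_Cconj (f : U -> C) (x : U) :
  continuous f x -> continuous (fun u => Cconj (f u)) x.
Proof.
  intros Hf; unfold Cconj; apply continuous_pair; [apply continuous_Re, Hf|].
  apply @continuous_opp; apply continuous_Im, Hf.
Qed.

Lemma continuous_Cmod (f : U -> C) (x : U) :
  continuous f x -> continuous (fun u => Cmod (f u)) x.
Proof.
  intros Hf; apply (continuous_comp f Cmod); [exact Hf|].
  apply (continuous_ext (fun z : C => norm (z : C_R_NormedModule))); [intros; symmetry; apply Cmod_norm|].
  exact (filterlim_norm (V := C_R_NormedModule) (f x)).
Qed.

End Continuity.

Lemma continuous_cis (u v x : R) : continuous (fun t => cis (u * t + v)) x.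
Proof.
  unfold cis; apply continuous_pair;
    apply @ex_derive_continuous; auto_derive; auto.
Qed.

Lemma continuous_peval_cis (a : nat -> C) (m : nat) (z : C) (x : R) :
  continuous (fun t => peval a m (z * cis t)%C) x.
Proof.
  induction m as [|m IH].
  - apply (continuous_ext (fun _ => a 0%nat)); [intros; rewrite peval_0; reflexivity|].
    apply continuous_const.
  - apply (continuous_ext (fun t => peval a m (z * cis t)
      + (a (S m) * z ^ S m) * cis (INR (S m) * t + 0))%C).
    + intros t; rewrite peval_S, Cpow_mult_l, cis_pow, Rplus_0_r.
      rewrite Cmult_assoc; reflexivity.
    + apply (continuous_plus (V := C_R_NormedModule)); [exact IH|].
      apply continuous_Cmult; [apply continuous_const | apply continuous_cis].
Qed.

(** * Integrals over the circle: rotations, weights, orthogonality *)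

Lemma is_RInt_Cmult (c : C) (h : R -> C) (x y : R) (l : C) :
  is_RInt (V := C_R_NormedModule) h x y l ->
  is_RInt (V := C_R_NormedModule) (fun t => c * h t)%C x y (c * l)%C.
Proof.
  intros H.
  (* [C_R_NormedModule] has real scalars, so a complex factor is handled on real and imaginary
     parts. *)
  generalize (is_RInt_fct_extend_fst (U := R_NormedModule) (V := R_NormedModule) _ _ _ _ H)
    (is_RInt_fct_extend_snd (U := R_NormedModule) (V := R_NormedModule) _ _ _ _ H).
  intros H1 H2.
  apply (is_RInt_fct_extend_pair (U := R_NormedModule) (V := R_NormedModule)).
  - apply (is_RInt_minus (V := R_NormedModule));
      apply (is_RInt_scal (V := R_NormedModule)); assumption.
  - apply (is_RInt_plus (V := R_NormedModule));
      apply (is_RInt_scal (V := R_NormedModule)); assumption.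
Qed.

(** Counterpart of [M1] for a partial sum; [is_lim_seq_pmean] shows that it converges to [M1]. *)
Definition pmean (a : nat -> C) (m : nat) (r : R) : R :=
  / (2 * PI) * RInt (fun t => Cmod (peval a m (r * cis t)%C)) 0 (2 * PI).

Lemma two_PI_pos : 0 < 2 * PI.
Proof. generalize PI_RGT_0; lra. Qed.

(** Splitting the integral over [0, 2 pi + s] at [s] and at 2 pi, the pieces [0, s] and
    [2 pi, 2 pi + s] agree by periodicity and cancel. *)
Lemma RInt_period_shift (h : R -> R) (s : R) :
  (forall t, continuous h t) -> (forall t, h (t + 2 * PI) = h t) ->
  RInt (fun t => h (t + s)) 0 (2 * PI) = RInt h 0 (2 * PI).
Proof.
  intros Hc Hp.
  assert (Hex : forall x y, ex_RInt h x y) by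
    (intros; apply (ex_RInt_continuous (V := R_CompleteNormedModule)); auto).
  assert (Hsh : forall v x y, RInt (fun t => h (t + v)) x y = RInt h (x + v) (y + v)).
  { intros v x y.
    generalize (RInt_comp_lin (V := R_CompleteNormedModule) h 1 v x y).
    rewrite !Rmult_1_l; intros <-; [|apply Hex].
    apply RInt_ext; intros t _; rewrite !Rmult_1_l; reflexivity. }
  rewrite Hsh, Rplus_0_l.
  assert (H1 : RInt h 0 s = RInt h (2 * PI) (2 * PI + s)).
  { rewrite <- (RInt_ext (fun t => h (t + 2 * PI))) by (intros; apply Hp).
    rewrite Hsh; f_equal; ring. }
  generalize (RInt_Chasles h 0 s (2 * PI + s) (Hex _ _) (Hex _ _))
    (RInt_Chasles h 0 (2 * PI) (2 * PI + s) (Hex _ _) (Hex _ _)).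
  unfold plus; simpl; intros; lra.
Qed.

Lemma cis_period (t : R) : cis (t + 2 * PI) = cis t.
Proof. rewrite cis_plus; unfold cis at 2; rewrite cos_2PI, sin_2PI. change (1, 0) with (RtoC 1). ring. Qed.

Lemma ex_RInt_Cmod_peval (a : nat -> C) (m : nat) (z : C) (x y : R) :
  ex_RInt (fun t => Cmod (peval a m (z * cis t)%C)) x y.
Proof.
  apply (ex_RInt_continuous (V := R_CompleteNormedModule)); intros.
  apply continuous_Cmod, continuous_peval_cis.
Qed.

Lemma pmean_rotate (a : nat -> C) (m : nat) (r s : R) :
  RInt (fun t => Cmod (peval a m (r * cis s * cis t)%C)) 0 (2 * PI)
  = 2 * PI * pmean a m r.
Proof.
  unfold pmean; rewrite <- Rmult_assoc, Rinv_r, Rmult_1_l by (generalize two_PI_pos; lra).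
  rewrite <- (RInt_period_shift (fun t => Cmod (peval a m (r * cis t)%C)) s).
  - apply RInt_ext; intros t _.
    rewrite (Rplus_comm t), cis_plus, Cmult_assoc; reflexivity.
  - intros; apply continuous_Cmod, continuous_peval_cis.
  - intros; rewrite cis_period; reflexivity.
Qed.

(** Since (z e^(it))^k = z^k e^(ikt), weighting by [g] and integrating multiplies the k-th
    coefficient by the moment [G k]: this is the polynomial F. *)
Lemma is_RInt_peval_weight (g : R -> C) (G : nat -> C) (a : nat -> C) (m : nat) (z : C) :
  (forall k, is_RInt (V := C_R_NormedModule) (fun t => cis (INR k * t) * g t)%C 0 (2 * PI) (G k)) ->
  is_RInt (V := C_R_NormedModule) (fun t => peval a m (z * cis t) * g t)%C 0 (2 * PI)
    (peval (fun k => a k * G k)%C m z).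
Proof.
  intros HG; induction m as [|m IH].
  - rewrite peval_0.
    apply (is_RInt_ext (V := C_R_NormedModule) (fun t => a 0%nat * (cis (INR 0 * t) * g t))%C).
    + intros t _; rewrite peval_0; simpl INR; rewrite Rmult_0_l, cis_0, Cmult_1_l; reflexivity.
    + apply is_RInt_Cmult, HG.
  - rewrite peval_S.
    apply (is_RInt_ext (V := C_R_NormedModule)
      (fun t => Cplus (peval a m (z * cis t) * g t)
                  (a (S m) * z ^ S m * (cis (INR (S m) * t) * g t)))%C).
    + intros t _; rewrite peval_S, Cpow_mult_l, cis_pow.
      match goal with |- ?x = ?y => change (@eq C x y) end; ring.
    + replace (a (S m) * G (S m) * z ^ S m)%C with (a (S m) * z ^ S m * G (S m))%C by ring.
      apply (is_RInt_plus (V := C_R_NormedModule)); [exact IH|].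
      apply is_RInt_Cmult, HG.
Qed.

(** The weight only decreases the modulus, and the rotation by [s] is absorbed by periodicity. F is
    not divided by 2 pi here, so that factor stays on the right. *)
Lemma Cmod_peval_weight_le (g : R -> C) (G : nat -> C) (a : nat -> C) (m : nat) (r s : R) :
  (forall k, is_RInt (V := C_R_NormedModule) (fun t => cis (INR k * t) * g t)%C 0 (2 * PI) (G k)) ->
  (forall t, Cmod (g t) <= 1) ->
  Cmod (peval (fun k => a k * G k)%C m (r * cis s)) <= 2 * PI * pmean a m r.
Proof.
  intros HG Hg; rewrite <- (pmean_rotate a m r s).
  rewrite Cmod_norm.
  apply (norm_RInt_le (V := C_R_NormedModule) (fun t => peval a m (r * cis s * cis t) * g t)%C
    (fun t => Cmod (peval a m (r * cis s * cis t)%C)) 0 (2 * PI)).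
  - generalize two_PI_pos; lra.
  - intros t _.
    rewrite <- Cmod_norm, Cmod_mult; generalize (Hg t) (Cmod_ge_0 (peval a m (r * cis s * cis t)%C)).
    intros; rewrite <- (Rmult_1_r (Cmod (peval _ _ _))) at 2; apply Rmult_le_compat_l; auto.
  - apply is_RInt_peval_weight, HG.
  - apply (RInt_correct (V := R_CompleteNormedModule)), ex_RInt_Cmod_peval.
Qed.

Lemma is_RInt_cis_0 (j : nat) (k : nat) : j <> k ->
  is_RInt (V := C_R_NormedModule) (fun t => cis (INR j * t) * cis (- INR k * t + 0))%C 0 (2 * PI) (RtoC 0).
Proof.
  intros Hjk.
  (* The difference is taken in Z, so that both orders of [j] and [k] are covered and [sin_eq_0_1]
     applies. *)
  set (n := (IZR (Z.of_nat j - Z.of_nat k))).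
  assert (Hn : n = INR j - INR k) by (unfold n; rewrite minus_IZR, <- !INR_IZR_INZ; reflexivity).
  assert (Hn0 : n <> 0) by (apply not_0_IZR; lia).
  assert (Hs : sin (n * (2 * PI)) = 0).
  { apply sin_eq_0_1; exists (2 * (Z.of_nat j - Z.of_nat k))%Z.
    rewrite mult_IZR; fold n; ring. }
  assert (Hc : cos (n * (2 * PI)) = 1).
  { replace (n * (2 * PI)) with (2 * (n * PI)) by ring.
    rewrite cos_2a_sin.
    replace (sin (n * PI)) with 0; [ring|].
    symmetry; apply sin_eq_0_1; exists (Z.of_nat j - Z.of_nat k)%Z; reflexivity. }
  apply (is_RInt_ext (V := C_R_NormedModule) (fun t => cis (n * t))).
  { intros t _; rewrite <- cis_plus, Hn; f_equal; ring. }
  apply (is_RInt_fct_extend_pair (U := R_NormedModule) (V := R_NormedModule)); simpl.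
  - replace 0 with (minus (sin (n * (2 * PI)) / n) (sin (n * 0) / n)) at 2.
    2:{ rewrite Hs, Rmult_0_r, sin_0; unfold minus, plus, opp; simpl; field; auto. }
    apply (is_RInt_derive (V := R_CompleteNormedModule) (fun t => sin (n * t) / n)).
    + intros; auto_derive; auto; field; auto.
    + intros; apply @ex_derive_continuous; auto_derive; auto.
  - replace 0 with (minus (- cos (n * (2 * PI)) / n) (- cos (n * 0) / n)) at 2.
    2:{ rewrite Hc, Rmult_0_r, cos_0; unfold minus, plus, opp; simpl; field; auto. }
    apply (is_RInt_derive (V := R_CompleteNormedModule) (fun t => - cos (n * t) / n)).
    + intros; auto_derive; auto; field; auto.
    + intros; apply @ex_derive_continuous; auto_derive; auto.
Qed.

Lemma is_RInt_cis_1 (k : nat) :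
  is_RInt (V := C_R_NormedModule) (fun t => cis (INR k * t) * cis (- INR k * t + 0))%C 0 (2 * PI) (RtoC (2 * PI)).
Proof.
  apply (is_RInt_ext (V := C_R_NormedModule) (fun t => (1, 0))).
  { intros t _; rewrite <- cis_plus; replace (_ + _) with 0 by ring; symmetry; apply cis_0. }
  apply (is_RInt_fct_extend_pair (U := R_NormedModule) (V := R_NormedModule)); simpl.
  - apply (eq_ind _ (is_RInt (fun _ : R => 1) 0 (2 * PI))
      (is_RInt_const (V := R_NormedModule) 0 (2 * PI) 1)).
    change ((2 * PI - 0) * 1 = 2 * PI); ring.
  - apply (eq_ind _ (is_RInt (fun _ : R => 0) 0 (2 * PI))
      (is_RInt_const (V := R_NormedModule) 0 (2 * PI) 0)).
    change ((2 * PI - 0) * 0 = 0); ring.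
Qed.

Lemma peval_single (c : nat -> C) (m k : nat) (z : C) : (k <= m)%nat ->
  (forall j, j <> k -> c j = 0%C) -> peval c m z = (c k * z ^ k)%C.
Proof.
  intros Hkm Hc.
  assert (H0 : forall i, (i < k)%nat -> peval c i z = 0%C).
  { induction i as [|i IH]; intros Hi.
    - rewrite peval_0; apply Hc; lia.
    - rewrite peval_S, IH, Hc by lia; ring. }
  induction Hkm as [|m Hkm IH].
  - destruct k as [|k]; [rewrite peval_0; change (z ^ 0)%C with (RtoC 1); ring|].
    rewrite peval_S, H0 by lia; ring.
  - rewrite peval_S, IH, (Hc (S m)) by lia; ring.
Qed.

(** With the weight e^(-ikt) all moments vanish except the k-th, which is 2 pi, and F is the
    monomial 2 pi a_k z^k: Cauchy's estimate with an L1 mean. *)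
Lemma coef_le_pmean (a : nat -> C) (m k : nat) (r : R) : 0 <= r -> (k <= m)%nat ->
  Cmod (a k) * r ^ k <= pmean a m r.
Proof.
  intros Hr Hkm.
  set (G := fun j => if Nat.eq_dec j k then RtoC (2 * PI) else 0%C).
  assert (H := Cmod_peval_weight_le (fun t => cis (- INR k * t + 0)) G a m r 0).
  rewrite (peval_single _ m k) in H; [|exact Hkm|].
  2:{ intros j Hj; unfold G; destruct (Nat.eq_dec j k); [tauto|ring]. }
  rewrite !Cmod_mult, Cmod_pow, (Cmod_Rcis r 0 Hr) in H.
  replace (G k) with (RtoC (2 * PI)) in H
    by (unfold G; destruct (Nat.eq_dec k k); tauto).
  rewrite Cmod_R, (Rabs_pos_eq (2 * PI)) in H by (generalize two_PI_pos; lra).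
  apply (Rmult_le_reg_l (2 * PI) _ _ two_PI_pos).
  rewrite <- Rmult_assoc, (Rmult_comm (2 * PI) (Cmod (a k))).
  apply H.
  - intros j; unfold G; destruct (Nat.eq_dec j k); [subst; apply is_RInt_cis_1 | apply is_RInt_cis_0; auto].
  - intros; rewrite Cmod_cis; lra.
Qed.

(** * The three circles theorem and convexity for polynomials *)

Lemma peval_ext (a b : nat -> C) (m : nat) (z : C) :
  (forall k, (k <= m)%nat -> a k = b k) -> peval a m z = peval b m z.
Proof.
  intros H; unfold peval; apply sum_n_ext_loc; intros k Hk; rewrite H; auto.
Qed.

Lemma peval_plus (a b : nat -> C) (m : nat) (z : C) :
  peval (fun k => a k + b k)%C m z = (peval a m z + peval b m z)%C.
Proof.
  induction m as [|m IH]; [rewrite !peval_0 | rewrite !peval_S, IH]; ring.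
Qed.

Lemma peval_scal (c : C) (a : nat -> C) (m : nat) (z : C) :
  peval (fun k => c * a k)%C m z = (c * peval a m z)%C.
Proof.
  induction m as [|m IH]; [rewrite !peval_0 | rewrite !peval_S, IH]; ring.
Qed.

(** [peval] carries a formal degree; padding by zeros lets [peval_mult] add polynomials of different
    degrees. *)
Lemma peval_pad (a : nat -> C) (m j : nat) (z : C) :
  peval (fun k => if Nat.leb k m then a k else 0%C) (j + m) z = peval a m z.
Proof.
  induction j as [|j IH].
  - apply peval_ext; intros k Hk; simpl in Hk.
    destruct (Nat.leb_spec k m); [reflexivity | lia].
  - rewrite Nat.add_succ_l, peval_S, IH.
    destruct (Nat.leb_spec (S (j + m)) m); [lia | ring].
Qed.

Lemma peval_S_l (a : nat -> C) (m : nat) (z : C) :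
  peval a (S m) z = (a 0%nat + z * peval (fun k => a (S k)) m z)%C.
Proof.
  induction m as [|m IH].
  - rewrite peval_S, !peval_0, Cpow_1_r; ring.
  - rewrite peval_S, IH, (peval_S (fun k => a (S k))), (Cpow_S z (S m)); ring.
Qed.

(** Induction on p = a_0 + z q replaces the convolution formula; the product is used later only
    through its values and its degree bound. *)
Lemma peval_mult (a b : nat -> C) (m n : nat) :
  exists d, forall z, (peval a m z * peval b n z)%C = peval d (m + n) z.
Proof.
  revert a; induction m as [|m IH]; intros a.
  - exists (fun k => a 0%nat * b k)%C; intros z; rewrite peval_0, peval_scal; reflexivity.
  - destruct (IH (fun k => a (S k))) as [d Hd].
    exists (fun k => a 0%nat * (if Nat.leb k n then b k else 0) +
      match k with O => 0 | S k => d k end)%C.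
    intros z; rewrite peval_plus, peval_scal, peval_pad, Nat.add_succ_l, (peval_S_l a).
    rewrite (peval_S_l (fun k => match k with O => _ | S k => d k end)), <- Hd; ring.
Qed.

Lemma peval_pow (a : nat -> C) (m N : nat) :
  exists d, forall z, (peval a m z ^ N)%C = peval d (N * m) z.
Proof.
  induction N as [|N [d Hd]].
  - exists (fun _ => 1%C); intros z; rewrite peval_0; reflexivity.
  - destruct (peval_mult a d m (N * m)) as [e He].
    exists e; intros z; rewrite Cpow_S, Hd, He; reflexivity.
Qed.

Lemma exp_le_compat (x y : R) : x <= y -> exp x <= exp y.
Proof. intros [H | ->]; [left; apply exp_increasing, H | right; reflexivity]. Qed.

Lemma pmean_le (a : nat -> C) (m : nat) (r A : R) :
  (forall t, Cmod (peval a m (r * cis t)) <= A) -> pmean a m r <= A.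
Proof.
  intros H; unfold pmean.
  apply (Rmult_le_reg_l (2 * PI) _ _ two_PI_pos).
  rewrite <- Rmult_assoc, Rinv_r, Rmult_1_l by (generalize two_PI_pos; lra).
  replace (2 * PI * A) with (RInt (fun _ => A) 0 (2 * PI)).
  - apply RInt_le; [generalize two_PI_pos; lra | apply ex_RInt_Cmod_peval | | auto].
    apply (ex_RInt_const (V := R_NormedModule)).
  - rewrite (RInt_const (V := R_CompleteNormedModule)).
    change ((2 * PI - 0) * A = 2 * PI * A); ring.
Qed.

(** If X = (1 + d) Q with d > 0, then (1 + d)^N <= N m + 1 for all N. Bernoulli's inequality is
    itself only linear in N, so it is squared: exponent 2N gives (1 + N d)^2 <= 2 N m + 1, which
    bounds N. *)
Lemma le_of_pow_le (X Q : R) (m : nat) : 0 < Q ->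
  (forall N, X ^ N <= INR (S (N * m)) * Q ^ N) -> X <= Q.
Proof.
  intros HQ H; apply Rnot_lt_le; intros HX.
  set (d := X / Q - 1).
  assert (Hd : 0 < d).
  { unfold d; apply Rlt_0_minus, (Rmult_lt_reg_r Q); auto.
    unfold Rdiv; rewrite Rmult_assoc, Rinv_l; lra. }
  assert (HXQ : X = (1 + d) * Q) by (unfold d; field; lra).
  assert (Hb : forall N, INR N * (d * d) < 2 * INR m + 1).
  { intros [|N]; [simpl; rewrite Rmult_0_l; generalize (pos_INR m); lra|].
    generalize (H (S N * 2)%nat); rewrite HXQ, Rpow_mult_distr.
    intros H1; apply Rmult_le_reg_r in H1; [|apply pow_lt; auto].
    rewrite pow_mult in H1.
    generalize (poly (S N) d Hd); intros H2.
    rewrite S_INR, !mult_INR in H1; simpl (INR 2) in H1.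
    assert (HN : 1 <= INR (S N)) by (rewrite S_INR; generalize (pos_INR N); lra).
    assert (H3 : (1 + INR (S N) * d) ^ 2 <= ((1 + d) ^ S N) ^ 2).
    { apply pow_incr; split; [nra | exact H2]. }
    set (n := INR (S N)) in *; set (M := INR m) in *.
    apply (Rmult_lt_reg_l n); [lra|]. nra. }
  destruct (nfloor_ex ((2 * INR m + 1) / (d * d))) as [N HN].
  { apply Rlt_le, Rdiv_lt_0_compat; [generalize (pos_INR m)|]; nra. }
  generalize (Hb (S N)); apply Rle_not_lt.
  rewrite S_INR; destruct HN as [_ HN].
  apply Rlt_le in HN; apply (Rmult_le_compat_r (d * d)) in HN; [|nra].
  unfold Rdiv in HN; rewrite Rmult_assoc, Rinv_l in HN by nra; lra.
Qed.

(* Tensor-power trick: the coefficients of F^N are at most exp (N L) / r^k at the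
   intermediate radius r, and F^N has only N m + 1 of them. *)
Lemma three_circles (c : nat -> C) (m : nat) (t1 t2 th A1 A2 : R) :
  0 <= th <= 1 -> 0 < A1 -> 0 < A2 ->
  (forall s, Cmod (peval c m (exp t1 * cis s)) <= A1) ->
  (forall s, Cmod (peval c m (exp t2 * cis s)) <= A2) ->
  Cmod (peval c m (exp ((1 - th) * t1 + th * t2) * cis 0))
    <= exp ((1 - th) * ln A1 + th * ln A2).
Proof.
  intros Hth HA1 HA2 H1 H2.
  set (t := (1 - th) * t1 + th * t2); set (L := (1 - th) * ln A1 + th * ln A2).
  apply (le_of_pow_le _ _ m); [apply exp_pos|]; intros N.
  destruct (peval_pow c m N) as [d Hd].
  rewrite <- Cmod_pow, Hd.
  assert (Hpow : forall x k, exp x ^ k = exp (INR k * x)).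
  { intros x k; induction k as [|k IH]; [simpl; rewrite Rmult_0_l, exp_0; reflexivity|].
    simpl pow; rewrite IH, <- exp_plus, S_INR; f_equal; ring. }
  assert (Hcoef : forall t' A, 0 < A -> (forall s, Cmod (peval c m (exp t' * cis s)) <= A) ->
    forall k, (k <= N * m)%nat -> d k <> 0%C ->
    ln (Cmod (d k)) + INR k * t' <= INR N * ln A).
  { intros t' A HA HF k Hk Hdk; apply Cmod_gt_0 in Hdk.
    rewrite <- (ln_exp (INR k * t')), <- Hpow, <- ln_pow, <- ln_mult by
      (auto; apply pow_lt, exp_pos).
    apply ln_le; [apply Rmult_lt_0_compat; auto; apply pow_lt, exp_pos|].
    eapply Rle_trans; [apply (coef_le_pmean d (N * m)); auto; apply Rlt_le, exp_pos|].
    apply pmean_le; intros s; rewrite <- Hd, Cmod_pow; apply pow_incr.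
    split; [apply Cmod_ge_0 | apply HF]. }
  eapply Rle_trans; [apply Cmod_peval_le|].
  rewrite Cmod_Rcis by (apply Rlt_le, exp_pos).
  apply Rle_trans with (sum_n (fun _ => exp L ^ N) (N * m)).
  2:{ rewrite sum_n_const; apply Rle_refl. }
  (* The two bounds in [Hcoef] are affine in the logarithm of the radius, so weighting them by 1 -
     th and th gives the bound at [t]. Vanishing coefficients have no usable logarithm and are
     treated apart. *)
  assert (Hterm : forall k, (k <= N * m)%nat -> Cmod (d k) * exp t ^ k <= exp L ^ N).
  { intros k Hk; destruct (Ceq_dec (d k) 0%C) as [->|Hdk].
    - rewrite Cmod_0, Rmult_0_l; apply Rlt_le, pow_lt, exp_pos.
    - generalize (Hcoef t1 A1 HA1 H1 k Hk Hdk) (Hcoef t2 A2 HA2 H2 k Hk Hdk); intros B1 B2.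
      apply Cmod_gt_0 in Hdk.
      rewrite <- (exp_ln (Cmod (d k))), !Hpow, <- exp_plus by auto.
      apply exp_le_compat; unfold t, L. set (x := ln (Cmod (d k))) in *. nra. }
  generalize (N * m)%nat Hterm; clear; intros M; induction M as [|M IH]; intros H.
  - rewrite !sum_O; apply H; lia.
  - rewrite !sum_Sn; apply Rplus_le_compat; [apply IH; intros; apply H; lia | apply H; lia].
Qed.

Lemma pmean_log_convex (a : nat -> C) (m : nat) (t1 t2 th : R) :
  0 <= th <= 1 -> 0 < pmean a m (exp t1) -> 0 < pmean a m (exp t2) ->
  pmean a m (exp ((1 - th) * t1 + th * t2))
    <= exp ((1 - th) * ln (pmean a m (exp t1)) + th * ln (pmean a m (exp t2))).
Proof.
  intros Hth H1 H2.
  set (r := exp ((1 - th) * t1 + th * t2)).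
  (* [eps] in the denominator keeps the weight continuous at zeros of [p]; the price is at most
     [eps] in the mean, because |p|^2 / (|p| + eps) >= |p| - eps. *)
  apply le_epsilon; intros eps Heps.
  set (p := fun t => peval a m (r * cis t)%C).
  set (w := fun t => / (Cmod (p t) + eps)).
  assert (Hden : forall t, 0 < Cmod (p t) + eps) by (intros t; generalize (Cmod_ge_0 (p t)); lra).
  set (g := fun t => (Cconj (p t) * RtoC (w t))%C).
  assert (Hp : forall t, continuous p t) by (intros; apply continuous_peval_cis).
  assert (Hw : forall t, continuous w t).
  { intros t; apply (continuous_comp (fun t => Cmod (p t) + eps) Rinv).
    - apply @continuous_plus; [apply continuous_Cmod, Hp | apply continuous_const].
    - apply continuous_Rinv; generalize (Hden t); lra. }
  assert (Hg : forall t, continuous g t).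
  { intros t; apply continuous_Cmult; [apply continuous_Cconj, Hp|].
    apply continuous_pair; [apply Hw | apply continuous_const]. }
  assert (Hg1 : forall t, Cmod (g t) <= 1).
  { intros t; unfold g; rewrite Cmod_mult, Cmod_conj, Cmod_R.
    rewrite Rabs_pos_eq by (apply Rlt_le, Rinv_0_lt_compat, Hden).
    apply (Rmult_le_reg_r (Cmod (p t) + eps)); [apply Hden|].
    unfold w; rewrite Rmult_assoc, Rinv_l by (generalize (Hden t); lra); lra. }
  set (G := fun k => RInt (V := C_R_CompleteNormedModule) (fun t => cis (INR k * t + 0) * g t)%C 0 (2 * PI)).
  assert (HG : forall k, is_RInt (V := C_R_NormedModule) (fun t => cis (INR k * t) * g t)%C 0 (2 * PI) (G k)).
  { intros k; apply (is_RInt_ext (V := C_R_NormedModule) (fun t => cis (INR k * t + 0) * g t)%C).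
    - intros; rewrite Rplus_0_r; reflexivity.
    - apply (RInt_correct (V := C_R_CompleteNormedModule)).
      apply (ex_RInt_continuous (V := C_R_CompleteNormedModule)); intros.
      apply continuous_Cmult; [apply continuous_cis | apply Hg]. }
  assert (Hpi := two_PI_pos).
  assert (H3 := three_circles (fun k => a k * G k)%C m t1 t2 th
    (2 * PI * pmean a m (exp t1)) (2 * PI * pmean a m (exp t2)) Hth
    (Rmult_lt_0_compat _ _ Hpi H1) (Rmult_lt_0_compat _ _ Hpi H2)
    (fun s => Cmod_peval_weight_le g G a m _ s HG Hg1)
    (fun s => Cmod_peval_weight_le g G a m _ s HG Hg1)).
  fold r in H3; rewrite cis_0, Cmult_1_r in H3.
  rewrite (ln_mult (2 * PI) (pmean a m (exp t1))),
    (ln_mult (2 * PI) (pmean a m (exp t2))) in H3 by auto.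
  (* The weights 1 - th and th add up to 1, so the factor 2 pi of both circles comes out as exactly
     one factor 2 pi. *)
  match type of H3 with _ <= exp ?x => replace x with (ln (2 * PI) + 
    ((1 - th) * ln (pmean a m (exp t1)) + th * ln (pmean a m (exp t2)))) in H3 by ring end.
  rewrite exp_plus, exp_ln in H3 by auto.
  set (Q := exp _) in H3 |- *.
  assert (H4 := is_RInt_peval_weight g G a m (RtoC r) HG).
  apply (is_RInt_fct_extend_fst (U := R_NormedModule) (V := R_NormedModule)) in H4.
  assert (H5 : is_RInt (fun t => Cmod (p t) - eps) 0 (2 * PI) (2 * PI * pmean a m r - (2 * PI - 0) * eps)).
  { apply (is_RInt_minus (V := R_NormedModule)).
    - unfold pmean; rewrite <- Rmult_assoc, Rinv_r, Rmult_1_l by lra.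
      apply (RInt_correct (V := R_CompleteNormedModule)), ex_RInt_Cmod_peval.
    - apply (is_RInt_const (V := R_NormedModule)). }
  assert (H6 := is_RInt_le _ _ 0 (2 * PI) _ _ (Rlt_le _ _ Hpi) H5 H4).
  assert (H7 : 2 * PI * pmean a m r - (2 * PI - 0) * eps <= 2 * PI * Q).
  { eapply Rle_trans; [apply H6|].
    - intros t _.
      assert (Hc : fst (p t * g t)%C = Cmod (p t) ^ 2 * w t).
      { unfold g; rewrite Cmult_assoc.
        unfold Cmod; rewrite pow2_sqrt by (generalize (pow2_ge_0 (fst (p t))) (pow2_ge_0 (snd (p t))); lra).
        simpl; ring. }
      change (Cmod (p t) - eps <= fst (p t * g t)%C); rewrite Hc.
      apply (Rmult_le_reg_r (Cmod (p t) + eps)); [apply Hden|].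
      unfold w; rewrite Rmult_assoc, Rinv_l by (generalize (Hden t); lra); nra.
    - eapply Rle_trans; [|exact H3].
      eapply Rle_trans; [apply Rle_abs | apply (re_le_Cmod (peval _ _ _))]. }
  apply (Rmult_le_reg_l (2 * PI)); [exact Hpi | lra].
Qed.

(** * Passage to power series *)

Lemma Series_tail_le (u b : nat -> R) (m : nat) :
  (forall k, Rabs (u k) <= b k) -> ex_series b ->
  Rabs (Series u - sum_n u m) <= Series b - sum_n b m.
Proof.
  intros Hub Hb.
  assert (Hu : ex_series u) by (apply (ex_series_le u b); auto).
  rewrite (Series_incr_n u (S m)), (Series_incr_n b (S m)) by (auto; lia).
  rewrite <- !sum_n_Reals; simpl pred.
  replace (_ + _ - _) with (Series (fun k => u (S m + k)%nat)) by ring.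
  replace (_ + _ - _) with (Series (fun k => b (S m + k)%nat)) by ring.
  assert (Hb' : ex_series (fun k => b (S m + k)%nat)) by (apply -> (ex_series_incr_n b); auto).
  eapply Rle_trans; [apply Series_Rabs | apply Series_le; auto].
  - apply (ex_series_le (fun k => Rabs (u (S m + k)%nat)) (fun k => b (S m + k)%nat)); auto.
    intros; change (Rabs (Rabs (u (S m + n)%nat)) <= b (S m + n)%nat); rewrite Rabs_Rabsolu; auto.
  - intros; split; [apply Rabs_pos | auto].
Qed.

Lemma ex_series_Cmod (a : nat -> C) (r : R) : 0 <= r -> Rbar_lt r (radius a) ->
  ex_series (fun k => Cmod (a k) * r ^ k).
Proof.
  intros Hr H.
  apply (ex_series_ext (fun k => Rabs (Cmod (a k) * r ^ k))).
  - intros k; apply Rabs_pos_eq, Rmult_le_pos; [apply Cmod_ge_0 | apply pow_le, Hr].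
  - apply (CV_disk_inside (fun k => Cmod (a k))); rewrite Rabs_pos_eq; auto.
Qed.

Lemma Cmod_le_Rabs (x y : R) : Cmod (x, y) <= Rabs x + Rabs y.
Proof.
  replace (x, y) with (RtoC x + Ci * RtoC y)%C
    by (unfold Cplus, Cmult, Ci; simpl; f_equal; ring).
  eapply Rle_trans; [apply Cmod_triangle|].
  rewrite Cmod_mult, !Cmod_R.
  replace (Cmod Ci) with 1; [lra|].
  unfold Cmod, Ci; simpl fst; simpl snd.
  replace (0 ^ 2 + 1 ^ 2) with 1 by ring; symmetry; apply sqrt_1.
Qed.

Lemma im_le_Cmod (z : C) : Rabs (Im z) <= Cmod z.
Proof. eapply Rle_trans; [apply Rmax_r | apply Rmax_Cmod]. Qed.

Lemma peval_components (a : nat -> C) (m : nat) (z : C) :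
  peval a m z = (sum_n (fun k => Re (a k * z ^ k)%C) m, sum_n (fun k => Im (a k * z ^ k)%C) m).
Proof.
  induction m as [|m IH].
  - rewrite peval_0, !sum_O; change (z ^ 0)%C with (RtoC 1); rewrite Cmult_1_r.
    destruct (a 0%nat); reflexivity.
  - rewrite peval_S, IH, !sum_Sn; reflexivity.
Qed.

(** [fval] sums real and imaginary parts separately; adding the two tail estimates gives the factor
    2. The bound depends on [z] only through its modulus, hence is uniform on circles. *)
Lemma fval_tail_le (a : nat -> C) (m : nat) (z : C) :
  Rbar_lt (Cmod z) (radius a) ->
  Cmod (fval a z - peval a m z)
    <= 2 * (Series (fun k => Cmod (a k) * Cmod z ^ k)
            - sum_n (fun k => Cmod (a k) * Cmod z ^ k) m).
Proof.
  intros Hz.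
  assert (Hb := ex_series_Cmod a (Cmod z) (Cmod_ge_0 z) Hz).
  rewrite peval_components; unfold fval.
  eapply Rle_trans; [apply Cmod_le_Rabs|].
  cbn [fst snd Copp].
  assert (H1 := Series_tail_le (fun k => Re (a k * z ^ k)%C) _ m
    (fun k => Rle_trans _ _ _ (re_le_Cmod (a k * z ^ k)%C)
      (Req_le _ _ (eq_trans (Cmod_mult _ _) (f_equal _ (Cmod_pow _ _))))) Hb).
  assert (H2 := Series_tail_le (fun k => Im (a k * z ^ k)%C) _ m
    (fun k => Rle_trans _ _ _ (im_le_Cmod (a k * z ^ k)%C)
      (Req_le _ _ (eq_trans (Cmod_mult _ _) (f_equal _ (Cmod_pow _ _))))) Hb).
  unfold Rminus in H1, H2 |- *; lra.
Qed.

Lemma is_lim_seq_pmean (a : nat -> C) (r : R) : 0 <= r -> Rbar_lt r (radius a) ->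
  is_lim_seq (fun m => pmean a m r) (M1 a r).
Proof.
  intros Hr HrR.
  set (b := fun k => Cmod (a k) * r ^ k).
  assert (Hb : ex_series b) by (apply ex_series_Cmod; auto).
  destruct (filterlim_RInt (V := R_CompleteNormedModule)
    (fun m t => Cmod (peval a m (r * cis t))) 0 (2 * PI) eventually _
    (fun t => Cmod (fval a (r * cos t, r * sin t)))
    (fun m => RInt (fun t => Cmod (peval a m (r * cis t))) 0 (2 * PI))) as [If [HI1 HI2]].
  - intros m; apply (RInt_correct (V := R_CompleteNormedModule)), ex_RInt_Cmod_peval.
  - apply filterlim_locally; intros eps.
    assert (Hlim : is_lim_seq (sum_n b) (Series b)) by (apply Series_correct, Hb).
    apply is_lim_seq_spec in Hlim.
    (* Half of [eps] makes up for the factor 2 in [fval_tail_le]; [m0] is independent of [t], as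
       uniform convergence demands. *)
    destruct (Hlim (pos_div_2 eps)) as [m0 Hm0].
    exists m0; intros m Hm t.
    change (Rabs (Cmod (peval a m (r * cis t)) - Cmod (fval a (r * cos t, r * sin t))) < eps).
    rewrite circle_cis.
    assert (Hz : Cmod (r * cis t) = r) by (apply Cmod_Rcis, Hr).
    generalize (fval_tail_le a m (r * cis t)%C); rewrite Hz; intros H; specialize (H HrR).
    fold b in H; specialize (Hm0 m Hm); simpl in Hm0.
    assert (Htr : Rabs (Cmod (peval a m (r * cis t)) - Cmod (fval a (r * cis t)))
      <= Cmod (fval a (r * cis t) - peval a m (r * cis t))).
    { set (x := peval a m (r * cis t)); set (y := fval a (r * cis t)).
      generalize (Cmod_triangle (y - x) x) (Cmod_triangle (x - y) y).
      replace (y - x + x)%C with y by ring. replace (x - y + y)%C with x by ring.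
      replace (Cmod (x - y)) with (Cmod (y - x))
        by (rewrite <- (Cmod_opp (y - x)); f_equal; ring).
      intros; apply Rabs_le; lra. }
    apply Rabs_lt_between in Hm0; lra.
  - unfold M1; rewrite (is_RInt_unique _ _ _ _ HI2).
    apply (is_lim_seq_scal_l _ (/ (2 * PI)) If), HI1.
Qed.

Lemma coef_le_M1 (a : nat -> C) (r : R) (k : nat) : 0 <= r -> Rbar_lt r (radius a) ->
  Cmod (a k) * r ^ k <= M1 a r.
Proof.
  intros Hr HrR.
  apply (is_lim_seq_le_loc (fun _ => Cmod (a k) * r ^ k) (fun m => pmean a m r)
    (Cmod (a k) * r ^ k) (M1 a r)).
  - exists k; intros m Hm; apply coef_le_pmean; auto.
  - apply is_lim_seq_const.
  - apply is_lim_seq_pmean; auto.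
Qed.

Lemma M1_pos (a : nat -> C) (k : nat) (r : R) : a k <> 0%C -> 0 < r -> Rbar_lt r (radius a) ->
  0 < M1 a r.
Proof.
  intros Hk Hr HrR; eapply Rlt_le_trans; [|apply (coef_le_M1 a r k); auto; lra].
  apply Rmult_lt_0_compat; [apply Cmod_gt_0, Hk | apply pow_lt, Hr].
Qed.

(* Hardy's convexity theorem. *)
Lemma ln_M1_convex (a : nat -> C) (k : nat) (t1 t2 th : R) : a k <> 0%C ->
  0 <= th <= 1 -> Rbar_lt (exp t1) (radius a) -> Rbar_lt (exp t2) (radius a) ->
  ln (M1 a (exp ((1 - th) * t1 + th * t2)))
    <= (1 - th) * ln (M1 a (exp t1)) + th * ln (M1 a (exp t2)).
Proof.
  intros Hk Hth H1 H2.
  set (t := (1 - th) * t1 + th * t2).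
  assert (H : Rbar_lt (exp t) (radius a)).
  { assert (Hmax : t <= Rmax t1 t2).
    { generalize (Rmax_l t1 t2) (Rmax_r t1 t2); unfold t; intros; nra. }
    apply (Rbar_le_lt_trans _ (exp (Rmax t1 t2))); [apply exp_le_compat, Hmax|].
    unfold Rmax; destruct (Rle_dec t1 t2); auto. }
  assert (Hp := M1_pos a k (exp t) Hk (exp_pos t) H).
  rewrite <- (ln_exp (_ + _)); apply ln_le; [exact Hp|].
  assert (Hl : forall t', Rbar_lt (exp t') (radius a) ->
    is_lim_seq (fun m => ln (pmean a m (exp t'))) (ln (M1 a (exp t')))).
  { intros t' Ht'; apply is_lim_seq_continuous.
    - apply continuity_pt_filterlim, continuous_ln, (M1_pos a k); auto; apply exp_pos.
    - apply is_lim_seq_pmean; auto; apply Rlt_le, exp_pos. }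
  apply (is_lim_seq_le_loc (fun m => pmean a m (exp t))
    (fun m => exp ((1 - th) * ln (pmean a m (exp t1)) + th * ln (pmean a m (exp t2))))
    (M1 a (exp t)) (exp ((1 - th) * ln (M1 a (exp t1)) + th * ln (M1 a (exp t2))))).
  (* The logarithms of the polynomial means are meaningful once the partial sum contains the nonzero
     k-th term. *)
  - assert (Hpos : forall t' m, (k <= m)%nat -> 0 < pmean a m (exp t')).
    { intros t' m Hm; eapply Rlt_le_trans; [|apply (coef_le_pmean a m k); auto].
      - apply Rmult_lt_0_compat; [apply Cmod_gt_0, Hk | apply pow_lt, exp_pos].
      - apply Rlt_le, exp_pos. }
    exists k; intros m Hm; apply pmean_log_convex; auto.
  - apply is_lim_seq_pmean; auto; apply Rlt_le, exp_pos.
  - apply is_lim_seq_continuous.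
    + apply derivable_continuous_pt, derivable_pt_exp.
    + apply (is_lim_seq_plus _ _ _ _ _ (is_lim_seq_scal_l _ (1 - th) _ (Hl t1 H1))
        (is_lim_seq_scal_l _ th _ (Hl t2 H2))).
      reflexivity.
Qed.

(** * Convexity in [ln r] *)

Definition ln_slope (s : R -> R) (x y : R) : R := (s y - s x) / (ln y - ln x).

(** Three-chord form of convexity in the variable ln r. Slopes are the quantities later compared
    with [n] and with [nu]. *)
Definition ln_convex (rho : Rbar) (s : R -> R) : Prop :=
  forall x y z, 0 < x -> x < y -> y < z -> Rbar_lt z rho ->
    ln_slope s x y <= ln_slope s x z /\ ln_slope s x z <= ln_slope s y z.

Lemma ln_slope_spec (s : R -> R) (x y : R) : 0 < x -> x < y ->
  s y - s x = ln_slope s x y * (ln y - ln x).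
Proof.
  intros Hx Hy; unfold ln_slope; field.
  generalize (ln_increasing x y Hx Hy); lra.
Qed.

Lemma ln_convex_ln_M1 (a : nat -> C) (k : nat) : a k <> 0%C ->
  ln_convex (radius a) (fun r => ln (M1 a r)).
Proof.
  intros Hk x y z Hx Hxy Hyz Hz.
  assert (H1 := ln_increasing x y Hx Hxy).
  assert (H2 := ln_increasing y z (Rlt_trans _ _ _ Hx Hxy) Hyz).
  set (th := (ln y - ln x) / (ln z - ln x)).
  assert (Hth : th * (ln z - ln x) = ln y - ln x) by (unfold th; field; lra).
  assert (H : ln (M1 a y) <= (1 - th) * ln (M1 a x) + th * ln (M1 a z)).
  { rewrite <- (exp_ln x), <- (exp_ln y), <- (exp_ln z) by lra.
    replace (ln y) with ((1 - th) * ln x + th * ln z) by lra.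
    apply (ln_M1_convex a k); auto.
    - unfold th; split; [apply Rlt_le, Rdiv_lt_0_compat; lra|].
      apply (Rmult_le_reg_r (ln z - ln x)); [lra|]; fold th; lra.
    - rewrite exp_ln by auto; apply (Rbar_lt_trans _ z); auto; simpl; lra.
    - rewrite exp_ln by lra; auto. }
  set (p := ln (M1 a x)) in *; set (q := ln (M1 a y)) in *; set (u := ln (M1 a z)) in *.
  unfold ln_slope; fold p q u.
  (* Convexity cleared of denominators; both slope inequalities are rearrangements of it. *)
  assert (Hq : (q - p) * (ln z - ln x) <= (u - p) * (ln y - ln x)).
  { rewrite <- Hth. set (D := ln z - ln x) in *. assert (0 < D) by (unfold D; lra). nra. }
  split.
  - apply (Rmult_le_reg_r ((ln y - ln x) * (ln z - ln x))); [nra|].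
    field_simplify; [|lra..]; lra.
  - apply (Rmult_le_reg_r ((ln z - ln y) * (ln z - ln x))); [nra|].
    field_simplify; [|lra..]; lra.
Qed.

Lemma Rbar_lt_between (x : R) (rho : Rbar) : Rbar_lt x rho -> exists z, x < z /\ Rbar_lt z rho.
Proof.
  destruct rho as [r| |]; simpl; intros H; [|exists (x + 1); split; [lra|exact I]|tauto].
  exists ((x + r) / 2); split; simpl; lra.
Qed.

(** Chords between [y] and nearby points have slopes between those of two fixed chords, one ending
    and one starting at [y]; so [s] is Lipschitz in ln r at [y]. *)
Lemma ln_convex_continuous (rho : Rbar) (s : R -> R) (y : R) :
  ln_convex rho s -> 0 < y -> Rbar_lt y rho -> continuous s y.
Proof.
  intros Hs Hy Hyr.
  destruct (Rbar_lt_between y rho Hyr) as [z [Hyz Hz]].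
  set (x := y / 2).
  set (K := Rabs (ln_slope s x y) + Rabs (ln_slope s y z) + 1).
  assert (HK : 0 < K)
    by (unfold K; generalize (Rabs_pos (ln_slope s x y)) (Rabs_pos (ln_slope s y z)); lra).
  assert (Hbound : forall w, x < w < z -> Rabs (s w - s y) <= K * Rabs (ln w - ln y)).
  { intros w [Hxw Hwz].
    assert (Hx : 0 < x) by (unfold x; lra).
    assert (Hxy : x < y) by (unfold x; lra).
    assert (Hbd : forall q, ln_slope s x y <= q -> q <= ln_slope s y z -> Rabs q <= K).
    { intros q Hq1 Hq2; unfold K.
      generalize (Rle_abs (ln_slope s y z)) (Rle_abs (- ln_slope s x y))
        (Rabs_pos (ln_slope s x y)) (Rabs_pos (ln_slope s y z)).
      rewrite Rabs_Ropp; intros; apply Rabs_le; lra. }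
    destruct (Rtotal_order w y) as [Hw|[->|Hw]].
    - rewrite Rabs_minus_sym, (Rabs_minus_sym (ln w)), (ln_slope_spec s w y), Rabs_mult by lra.
      apply Rmult_le_compat_r; [apply Rabs_pos|]; apply Hbd.
      + apply (Hs x w y); auto.
      + apply Rle_trans with (ln_slope s w z); apply (Hs w y z); auto; lra.
    - rewrite !Rminus_diag, Rabs_R0; lra.
    - rewrite (ln_slope_spec s y w), Rabs_mult by lra.
      apply Rmult_le_compat_r; [apply Rabs_pos|]; apply Hbd.
      + apply Rle_trans with (ln_slope s x w); apply (Hs x y w); auto;
          apply (Rbar_lt_trans _ z); auto.
      + apply (Hs y w z); auto. }
  apply filterlim_locally; intros eps.
  assert (Hln := continuous_ln y Hy).
  assert (He : 0 < eps / K) by (apply Rdiv_lt_0_compat; [apply cond_pos | auto]).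
  apply filterlim_locally with (eps := mkposreal _ He) in Hln.
  assert (Hx1 : locally y (fun w => x < w)) by (apply open_gt; unfold x; lra).
  assert (Hz1 : locally y (fun w => w < z)) by (apply open_lt; lra).
  generalize (filter_and _ _ Hln (filter_and _ _ Hx1 Hz1)); apply filter_imp.
  intros w [H1 H2]; specialize (Hbound w H2).
  change (Rabs (ln w - ln y) < eps / K) in H1.
  change (Rabs (s w - s y) < eps).
  eapply Rle_lt_trans; [exact Hbound|].
  replace (pos eps) with (K * (eps / K)) by (field; lra).
  apply Rmult_lt_compat_l; auto.
Qed.

(* Coquelicot's [Derive] takes its limit along [h = / (n + 1)], so only difference quotients
   to the right of [r] matter and differentiability is not required. *)
Lemma Derive_ln_slope_bounds (s : R -> R) (r d K1 K2 : R) : 0 < r -> 0 < d ->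
  (forall w, r < w < r + d -> K1 <= ln_slope s r w <= K2) ->
  K1 <= r * Derive s r <= K2.
Proof.
  intros Hr Hd H.
  set (h := fun k => Rbar_loc_seq 0 k).
  assert (Hh : forall k, 0 < h k).
  { intros k; unfold h; simpl; rewrite Rplus_0_l; apply Rinv_0_lt_compat.
    generalize (pos_INR k); lra. }
  assert (Hhd : forall e, 0 < e -> eventually (fun k => h k < e)).
  { intros e He; destruct (nfloor_ex (/ e)) as [N [_ HN]]; [left; apply Rinv_0_lt_compat, He|].
    exists N; intros k Hk; unfold h; simpl; rewrite Rplus_0_l.
    rewrite <- (Rinv_inv e); apply Rinv_lt_contravar.
    - apply Rmult_lt_0_compat; [apply Rinv_0_lt_compat, He | generalize (pos_INR k); lra].
    - apply le_INR in Hk; lra. }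
  (* The ratio of a quotient in [r] to the slope in ln r; it tends to the derivative 1/r of ln,
     which the factor [r] in the conclusion cancels. *)
  set (v := fun k => (ln (r + h k) - ln r) / h k).
  assert (Hv : is_lim_seq v (/ r)).
  { apply is_lim_seq_spec; intros eps.
    destruct (derivable_pt_lim_ln r Hr eps (cond_pos eps)) as [del Hdel].
    generalize (Hhd del (cond_pos del)); apply filter_imp; intros k Hk.
    apply Hdel; [generalize (Hh k); lra|].
    rewrite Rabs_pos_eq; [exact Hk | left; apply Hh]. }
  assert (Hle : eventually (fun k => K1 * v k <= (s (r + h k) - s r) / h k <= K2 * v k)).
  { generalize (Hhd d Hd); apply filter_imp; intros k Hk.
    specialize (Hh k).
    assert (Hln : ln r < ln (r + h k)) by (apply ln_increasing; lra).
    rewrite ln_slope_spec by lra.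
    assert (Hvk : 0 < v k) by (apply Rdiv_lt_0_compat; lra).
    replace (ln_slope s r (r + h k) * (ln (r + h k) - ln r) / h k)
      with (ln_slope s r (r + h k) * v k) by (unfold v; field; lra).
    destruct (H (r + h k)) as [H1 H2]; [lra|].
    split; apply Rmult_le_compat_r; lra. }
  assert (HKv : forall K, Lim_seq (fun k => K * v k) = Finite (K * / r)).
  { intros K; apply is_lim_seq_unique, (is_lim_seq_scal_l v K (/ r)), Hv. }
  assert (L1 : Rbar_le (K1 * / r) (Lim_seq (fun k => (s (r + h k) - s r) / h k))).
  { rewrite <- HKv; apply Lim_seq_le_loc; revert Hle; apply filter_imp; tauto. }
  assert (L2 : Rbar_le (Lim_seq (fun k => (s (r + h k) - s r) / h k)) (K2 * / r)).
  { rewrite <- HKv; apply Lim_seq_le_loc; revert Hle; apply filter_imp; tauto. }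
  unfold Derive, Lim; fold h.
  change (Lim_seq (fun n => (s (r + Rbar_loc_seq 0 n) - s r) / Rbar_loc_seq 0 n))
    with (Lim_seq (fun k => (s (r + h k) - s r) / h k)).
  (* Finite bounds on both sides exclude infinite limits, so the real number extracted by [Derive]
     is not a default value. *)
  destruct (Lim_seq (fun k => (s (r + h k) - s r) / h k)) as [l| |]; simpl in L1, L2; try tauto.
  simpl; apply (Rmult_le_compat_l r) in L1; [|lra]; apply (Rmult_le_compat_l r) in L2; [|lra].
  replace (r * (K1 * / r)) with K1 in L1 by (field; lra).
  replace (r * (K2 * / r)) with K2 in L2 by (field; lra).
  split; assumption.
Qed.

Lemma filterlim_at_left_increasing (f : R -> R) (c b : R) : c < b ->
  (forall x y, c < x -> x <= y -> y < b -> f x <= f y) ->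
  exists L : Rbar, filterlim f (at_left b) (Rbar_locally L).
Proof.
  intros Hcb Hf.
  set (E := fun v => exists x, c < x < b /\ v = f x).
  assert (HE := Lub_Rbar_correct E).
  assert (Hnear : forall x, c < x < b -> at_left b (fun y => x < y /\ y < b)).
  { intros x Hx; exists (mkposreal (b - x) ltac:(lra)); intros y Hy Hyb.
    change (Rabs (y - b) < b - x) in Hy; apply Rabs_lt_between in Hy; lra. }
  exists (Lub_Rbar E); destruct (Lub_Rbar E) as [l| |]; destruct HE as [Hub Hlub].
  - apply filterlim_locally; intros eps.
    destruct (excluded_middle_informative (exists x, c < x < b /\ l - eps < f x)) as [[x [Hx Hfx]]|Hno].
    + generalize (Hnear x Hx); apply filter_imp; intros y Hy.
      change (Rabs (f y - l) < eps).
      assert (f x <= f y) by (apply Hf; lra).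
      assert (f y <= l) by (apply Hub; exists y; split; [lra | reflexivity]).
      generalize (cond_pos eps); intros; apply Rabs_lt_between; lra.
    + exfalso; assert (H : Rbar_le l (l - eps)).
      { apply Hlub; intros v [x [Hx ->]]; simpl.
        apply Rnot_lt_le; intros Hl; apply Hno; exists x; auto. }
      simpl in H; generalize (cond_pos eps); lra.
  - intros P [M HM]; change (at_left b (fun y => P (f y))).
    destruct (excluded_middle_informative (exists x, c < x < b /\ M < f x)) as [[x [Hx Hfx]]|Hno].
    + generalize (Hnear x Hx); apply filter_imp; intros y Hy; apply HM.
      assert (f x <= f y) by (apply Hf; lra); lra.
    + exfalso; apply (Hlub M); intros v [x [Hx ->]]; simpl.
      apply Rnot_lt_le; intros Hl; apply Hno; exists x; auto.
  - exfalso; apply (Hub (f ((c + b) / 2))); exists ((c + b) / 2); split; [lra | reflexivity].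
Qed.

(** [M1R] is chosen by [epsilon], so a limit must be exhibited. By convexity, one pair x < y with M1
    x <= M1 y makes [M1] nondecreasing beyond y; without such a pair [M1] decreases throughout, and
    the monotone limit is taken for its negative. *)
Lemma filterlim_M1_M1R (a : nat -> C) (k : nat) (b : R) : a k <> 0%C -> 0 < b ->
  radius a = Finite b -> filterlim (M1 a) (at_left b) (Rbar_locally (M1R a)).
Proof.
  intros Hk Hb Hrad; unfold M1R; rewrite Hrad; apply epsilon_spec.
  assert (Hc := ln_convex_ln_M1 a k Hk); rewrite Hrad in Hc.
  assert (Hpos : forall x, 0 < x < b -> 0 < M1 a x)
    by (intros; apply (M1_pos a k); rewrite ?Hrad; simpl; tauto).
  assert (Hle : forall x y, 0 < x < b -> 0 < y < b -> ln (M1 a x) <= ln (M1 a y) -> M1 a x <= M1 a y).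
  { intros x y Hx Hy H; rewrite <- (exp_ln (M1 a x)), <- (exp_ln (M1 a y)) by auto.
    apply exp_le_compat, H. }
  destruct (excluded_middle_informative
    (exists x y, 0 < x /\ x < y /\ y < b /\ M1 a x <= M1 a y)) as [[x [y [Hx [Hxy [Hyb H]]]]]|Hno].
  - apply (filterlim_at_left_increasing _ y b Hyb); intros u v Hu [Huv| ->] Hv; [|lra].
    apply Hle; [lra..|].
    apply Rminus_le_0; rewrite (ln_slope_spec (fun r => ln (M1 a r))) by lra.
    apply Rmult_le_pos; [|generalize (ln_increasing u v); lra].
    (* Slopes increase along the chords xy, xu, yu, yv, uv, and the first one is nonnegative. *)
    apply Rle_trans with (ln_slope (fun r => ln (M1 a r)) x y).
    + unfold ln_slope; apply Rmult_le_pos.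
      * apply -> Rminus_le_0; apply ln_le; [apply Hpos; lra | exact H].
      * left; apply Rinv_0_lt_compat; generalize (ln_increasing x y); lra.
    + apply Rle_trans with (ln_slope (fun r => ln (M1 a r)) y u);
        [apply Rle_trans with (ln_slope (fun r => ln (M1 a r)) x u); apply (Hc x y u) |
         apply Rle_trans with (ln_slope (fun r => ln (M1 a r)) y v); apply (Hc y u v)];
        simpl; lra.
  - destruct (filterlim_at_left_increasing (fun r => - M1 a r) 0 b Hb) as [L HL].
    + intros x y Hx [Hxy| ->] Hy; [|lra].
      apply Ropp_le_contravar, Rnot_lt_le; intros H; apply Hno; exists x, y; repeat split; lra.
    + exists (Rbar_opp L).
      apply (filterlim_ext (fun r => - - M1 a r)); [intros; ring|].
      apply (filterlim_comp _ _ _ (fun r => - M1 a r) Ropp _ (Rbar_locally L)); [exact HL|].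
      apply filterlim_Rbar_opp.
Qed.

(** * Existence of optimal radii *)

Lemma smallest_minimizer (G : R -> R) (al be : R) : al <= be ->
  (forall s, al <= s <= be -> continuous G s) ->
  exists m, al <= m <= be /\
    forall s, al <= s <= be -> G m <= G s /\ (G s = G m -> m <= s).
Proof.
  intros Hab HG.
  destruct (continuity_ab_min G al be Hab) as [mx [Hmin Hmx]].
  { intros c Hc; apply continuity_pt_filterlim, HG, Hc. }
  (* The minimizers are reflected, so that the supremum given by [completeness] yields the least of
     them. *)
  set (E := fun x => al <= - x <= be /\ G (- x) = G mx).
  destruct (completeness E) as [u [Hub Hlub]].
  { exists (- al); intros x [Hx _]; lra. }
  { exists (- mx); unfold E; rewrite Ropp_involutive; auto. }
  assert (Hm : al <= - u <= be).
  { split.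
    - assert (u <= - al) by (apply Hlub; intros x [Hx _]; lra); lra.
    - assert (- mx <= u) by (apply Hub; unfold E; rewrite Ropp_involutive; auto); lra. }
  assert (HGm : G (- u) = G mx).
  { apply Rle_antisym; [|apply Hmin, Hm].
    apply Rnot_lt_le; intros Hlt.
    assert (He : 0 < G (- u) - G mx) by lra.
    assert (Hc := HG _ Hm).
    apply filterlim_locally with (eps := mkposreal _ He) in Hc.
    destruct Hc as [del Hdel].
    (* Were G(-u) above the minimum, continuity would keep a neighbourhood of -u free of minimizers,
       and [u] could be lowered by [del]. *)
    assert (u <= u - del).
    { apply Hlub; intros x Hx; apply Rnot_lt_le; intros Hxu.
      assert (x <= u) by (apply Hub, Hx); destruct Hx as [Hx1 Hx2].
      specialize (Hdel (- x)).
      change (Rabs (- x - - u) < del -> Rabs (G (- x) - G (- u)) < G (- u) - G mx) in Hdel.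
      rewrite Hx2, (Rabs_minus_sym (G mx)), (Rabs_pos_eq (G (- u) - G mx)) in Hdel by lra.
      apply (Rlt_irrefl (G (- u) - G mx)), Hdel; apply Rabs_lt_between; lra. }
    generalize (cond_pos del); lra. }
  exists (- u); split; [exact Hm|]; intros s Hs; rewrite HGm; split; [apply Hmin, Hs|].
  intros Heq; assert (- s <= u) by (apply Hub; unfold E; rewrite Ropp_involutive; auto); lra.
Qed.

(** Carries comparisons on the open disk over to [M1R], which is accessible only as a left limit. *)
Lemma at_left_le (f g : R -> R) (L : Rbar) (c b : R) : c < b ->
  filterlim f (at_left b) (Rbar_locally L) -> continuous g b ->
  ((forall y, c < y < b -> f y <= g y) -> Rbar_le L (g b)) /\
  ((forall y, c < y < b -> g y <= f y) -> Rbar_le (g b) L).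
Proof.
  intros Hcb Hf Hg.
  assert (Hg' : filterlim g (at_left b) (Rbar_locally (g b))).
  { intros P HP; specialize (Hg P HP); unfold filtermap, at_left, within in Hg |- *.
    revert Hg; apply filter_imp; auto. }
  assert (Hn : at_left b (fun y => c < y < b)).
  { exists (mkposreal (b - c) ltac:(lra)); intros y Hy Hyb.
    change (Rabs (y - b) < b - c) in Hy; apply Rabs_lt_between in Hy; lra. }
  split; intros H.
  - apply (filterlim_le (F := at_left b) f g L (g b)); auto.
    revert Hn; apply filter_imp; auto.
  - apply (filterlim_le (F := at_left b) g f (g b) L); auto.
    revert Hn; apply filter_imp; auto.
Qed.

Lemma continuous_M1 (a : nat -> C) (k : nat) (r : R) : a k <> 0%C -> 0 < r ->
  Rbar_lt r (radius a) -> continuous (M1 a) r.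
Proof.
  intros Hk Hr HrR.
  destruct (Rbar_lt_between r _ HrR) as [z [Hrz Hz]].
  apply (continuous_ext_loc _ (fun y => exp (ln (M1 a y)))).
  - assert (H1 : locally r (fun w => 0 < w)) by (apply open_gt; lra).
    assert (H2 : locally r (fun w => w < z)) by (apply open_lt; lra).
    generalize (filter_and _ _ H1 H2); apply filter_imp; intros y Hy.
    apply exp_ln, (M1_pos a k); try tauto.
    apply (Rbar_lt_trans _ z); [simpl; tauto | exact Hz].
  - apply (continuous_comp (fun y => ln (M1 a y)) exp).
    + apply (ln_convex_continuous (radius a)); auto; apply (ln_convex_ln_M1 a k Hk).
    + apply continuity_pt_filterlim, derivable_continuous_pt, derivable_pt_exp.
Qed.

Lemma continuous_div_pow (K : R -> R) (n : nat) (s : R) : 0 < s -> continuous K s ->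
  continuous (fun x => K x / x ^ n) s.
Proof.
  intros Hs HK; apply (continuous_mult (K := R_AbsRing) K (fun x => / x ^ n)); [exact HK|].
  apply @ex_derive_continuous; auto_derive; apply pow_nonzero; lra.
Qed.

Lemma obj_interior (a : nat -> C) (n : nat) (r : R) : Rbar_lt r (radius a) ->
  obj a n r = Finite (M1 a r / r ^ n).
Proof. intros H; unfold obj; destruct (Rbar_lt_dec r (radius a)); tauto. Qed.

Lemma obj_boundary (a : nat -> C) (n : nat) (b : R) : radius a = Finite b ->
  obj a n b = Rbar_mult (/ b ^ n) (M1R a).
Proof.
  intros H; unfold obj; destruct (Rbar_lt_dec b (radius a)) as [H1|]; [|reflexivity].
  rewrite H in H1; simpl in H1; lra.
Qed.

Lemma M1R_nonneg (a : nat -> C) (k : nat) : a k <> 0%C -> Rbar_lt 0 (radius a) ->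
  Rbar_le 0 (M1R a).
Proof.
  intros Hk HR; destruct (radius a) as [b| |] eqn:Hrad.
  - simpl in HR.
    apply (at_left_le (M1 a) (fun _ => 0) (M1R a) 0 b HR).
    + apply (filterlim_M1_M1R a k); auto.
    + apply continuous_const.
    + intros y Hy; left; apply (M1_pos a k); try tauto; rewrite Hrad; simpl; tauto.
  - unfold M1R; rewrite Hrad; exact I.
  - simpl in HR; tauto.
Qed.

Lemma obj_boundary_finite (a : nat -> C) (n : nat) (b L : R) : radius a = Finite b ->
  M1R a = Finite L -> obj a n b = Finite (L / b ^ n).
Proof.
  intros H HL; rewrite (obj_boundary a n b H), HL; simpl; f_equal; unfold Rdiv; ring.
Qed.

Lemma obj_boundary_infty (a : nat -> C) (n : nat) (b : R) : 0 < b -> radius a = Finite b ->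
  M1R a = p_infty -> obj a n b = p_infty.
Proof.
  intros Hb H HL; rewrite (obj_boundary a n b H), HL.
  apply is_Rbar_mult_unique, is_Rbar_mult_sym, is_Rbar_mult_p_infty_pos; simpl.
  apply Rinv_0_lt_compat, pow_lt, Hb.
Qed.

(** Outside [al, be] the objective is strictly worse than at the reference point [c]. Strictness
    excludes ties there too, so the smallest minimizer on the interval is the smallest one
    overall. *)
Lemma opt_exists_compact (a : nat -> C) (n : nat) (G : R -> R) (al c be : R) :
  0 < al -> al <= c <= be -> Rbar_le be (radius a) ->
  (forall s, al <= s <= be -> continuous G s) ->
  (forall s, al <= s <= be -> obj a n s = Finite (G s)) ->
  (forall s, 0 < s -> Rbar_le s (radius a) -> s < al \/ be < s ->
     Rbar_lt (obj a n c) (obj a n s)) ->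
  exists m, is_opt_radius a n m.
Proof.
  intros Hal Hc Hbe HG Hobj Hout.
  destruct (smallest_minimizer G al be) as [m [Hm Hmin]]; [lra | exact HG|].
  exists m.
  assert (Hin : forall s, 0 < s -> Rbar_le s (radius a) -> al <= s <= be \/ Rbar_lt (obj a n m) (obj a n s)).
  { intros s Hs HsR.
    destruct (Rlt_le_dec s al) as [H|H]; [|destruct (Rlt_le_dec be s) as [H'|H']; [|left; lra]];
      right; (apply Rbar_le_lt_trans with (obj a n c); [|apply Hout; auto]);
      rewrite !Hobj by auto; apply Hmin, Hc. }
  repeat split.
  - lra.
  - apply Rbar_le_trans with be; [simpl; lra | exact Hbe].
  - intros s Hs HsR; destruct (Hin s Hs HsR) as [H|H]; [|apply Rbar_lt_le, H].
    rewrite !Hobj by auto; apply Hmin, H.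
  - intros s Hs HsR Heq; destruct (Hin s Hs HsR) as [H|H].
    + rewrite !Hobj in Heq by auto; injection Heq; apply Hmin, H.
    + exfalso; rewrite Heq in H; revert H; apply Rbar_le_not_lt, Rbar_le_refl.
Qed.

Lemma obj_large_near_0 (a : nat -> C) (k n : nat) (v : R) : a k <> 0%C -> (k < n)%nat ->
  exists al, 0 < al /\ forall s, 0 < s < al -> Rbar_lt s (radius a) -> v < M1 a s / s ^ n.
Proof.
  intros Hk Hkn; set (A := Cmod (a k)).
  assert (HA : 0 < A) by (apply Cmod_gt_0, Hk).
  set (w := Rmax v 1).
  assert (Hw : v <= w /\ 1 <= w) by (split; [apply Rmax_l | apply Rmax_r]).
  (* The lower bound A s^(k-n) is at least A/s for s < 1, and exceeds [w] for s < A/w; replacing [v]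
     by w >= 1 keeps the quotient positive. *)
  exists (Rmin 1 (A / w)); split.
  { apply Rmin_glb_lt; [lra | apply Rdiv_lt_0_compat; lra]. }
  intros s [Hs Hs'] HsR.
  assert (Hs1 : s < 1) by (eapply Rlt_le_trans; [exact Hs' | apply Rmin_l]).
  assert (HsA : s * w < A).
  { apply (Rmult_lt_reg_r (/ w)); [apply Rinv_0_lt_compat; lra|].
    rewrite Rmult_assoc, Rinv_r by lra; rewrite Rmult_1_r.
    eapply Rlt_le_trans; [exact Hs' | apply Rmin_r]. }
  destruct (Nat.le_exists_sub (S k) n) as [j [Hj _]]; [lia|].
  assert (Hn : s ^ n = s ^ k * s * s ^ j)
    by (rewrite Hj, Nat.add_succ_r, <- Nat.add_succ_l, pow_add; simpl; ring).
  assert (Hsk : 0 < s ^ k) by (apply pow_lt; auto).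
  assert (Hsj : 0 < s ^ j <= 1).
  { split; [apply pow_lt; auto|]. rewrite <- (pow1 j); apply pow_incr; lra. }
  assert (HM := coef_le_M1 a s k (Rlt_le _ _ Hs) HsR); fold A in HM.
  apply (Rmult_lt_reg_r (s ^ n)); [apply pow_lt; auto|].
  unfold Rdiv; rewrite Rmult_assoc, Rinv_l by (apply pow_nonzero; lra).
  apply Rle_lt_trans with (s ^ k * (s * w)).
  - rewrite Hn. apply Rle_trans with (w * (s ^ k * s * s ^ j)).
    + apply Rmult_le_compat_r; [|lra]. left; repeat apply Rmult_lt_0_compat; lra.
    + replace (w * (s ^ k * s * s ^ j)) with (s ^ k * (s * w) * s ^ j) by ring.
      rewrite <- (Rmult_1_r (s ^ k * (s * w))) at 2.
      apply Rmult_le_compat_l; [|lra]. left; repeat apply Rmult_lt_0_compat; lra.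
  - rewrite Rmult_1_r; eapply Rlt_le_trans; [|exact HM].
    rewrite (Rmult_comm A); apply Rmult_lt_compat_l; auto.
Qed.

(** A nonzero coefficient of index above [n] gives the lower bound |a_k| s^(k-n), which is at least
    |a_k| s for s > 1. *)
Lemma obj_large_near_infty (a : nat -> C) (k n : nat) (v : R) : a k <> 0%C -> (n < k)%nat ->
  exists be, forall s, be < s -> Rbar_lt s (radius a) -> v < M1 a s / s ^ n.
Proof.
  intros Hk Hkn; set (A := Cmod (a k)).
  assert (HA : 0 < A) by (apply Cmod_gt_0, Hk).
  exists (Rmax 1 (v / A)); intros s Hs HsR.
  assert (Hs1 : 1 < s) by (eapply Rle_lt_trans; [apply Rmax_l | exact Hs]).
  assert (HsA : v < A * s).
  { replace v with (A * (v / A)) by (field; lra).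
    apply Rmult_lt_compat_l; auto; eapply Rle_lt_trans; [apply Rmax_r | exact Hs]. }
  destruct (Nat.le_exists_sub (S n) k) as [j [Hj _]]; [lia|].
  assert (Hn : s ^ k = s ^ n * s * s ^ j)
    by (rewrite Hj, Nat.add_succ_r, <- Nat.add_succ_l, pow_add; simpl; ring).
  assert (HM := coef_le_M1 a s k ltac:(lra) HsR); fold A in HM.
  assert (Hsn : 0 < s ^ n) by (apply pow_lt; lra).
  apply Rlt_le_trans with (A * s * s ^ j).
  - eapply Rlt_le_trans; [exact HsA|].
    rewrite <- (Rmult_1_r (A * s)) at 1; apply Rmult_le_compat_l.
    + left; apply Rmult_lt_0_compat; lra.
    + apply pow_R1_Rle; lra.
  - apply (Rmult_le_reg_r (s ^ n)); auto.
    unfold Rdiv; rewrite (Rmult_assoc (M1 a s)), Rinv_l, Rmult_1_r by lra.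
    eapply Rle_trans; [|exact HM]; rewrite Hn; right; ring.
Qed.

Lemma opt_exists (a : nat -> C) (k n : nat) : a k <> 0%C -> (k < n)%nat ->
  Rbar_lt 0 (radius a) ->
  ~ (exists N : nat, forall j : nat, (N <= j)%nat -> a j = 0%C) ->
  exists m, is_opt_radius a n m.
Proof.
  intros Hk Hkn HR Hnp.
  destruct (Rbar_lt_between 0 _ HR) as [c [Hc HcR]].
  set (v := M1 a c / c ^ n).
  destruct (obj_large_near_0 a k n v Hk Hkn) as [al' [Hal' Hnear0]].
  set (al := Rmin al' c).
  assert (Hal : 0 < al <= c /\ al <= al').
  { unfold al; repeat split; [apply Rmin_glb_lt | apply Rmin_r | apply Rmin_l]; auto. }
  assert (Hout0 : forall s, 0 < s -> s < al -> Rbar_lt (obj a n c) (obj a n s)).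
  { intros s Hs Hsa.
    assert (HsR : Rbar_lt s (radius a)) by (apply (Rbar_lt_trans _ c); auto; simpl; lra).
    rewrite !obj_interior by auto; apply Hnear0; auto; lra. }
  assert (Hcont : forall s be, al <= s <= be -> Rbar_lt be (radius a) ->
    continuous (fun x => M1 a x / x ^ n) s /\ obj a n s = Finite (M1 a s / s ^ n)).
  { intros s be Hs HbeR.
    assert (HsR : Rbar_lt s (radius a)) by (apply (Rbar_le_lt_trans _ be); auto; simpl; lra).
    split; [|apply obj_interior, HsR].
    apply continuous_div_pow; [lra|]. apply (continuous_M1 a k); auto; lra. }
  destruct (radius a) as [b| |] eqn:Hrad; [| |simpl in HR; tauto].
  - simpl in HR, HcR.
    assert (Hlim := filterlim_M1_M1R a k b Hk HR Hrad).
    assert (H0 := M1R_nonneg a k Hk); rewrite Hrad in H0; specialize (H0 HR).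
    destruct (M1R a) as [L| |] eqn:HL; [| |simpl in H0; tauto].
    (* Extending [M1] by its limit at [b] makes the objective continuous on the closed interval. *)
    + set (K := fun s => if Rlt_dec s b then M1 a s else L).
      apply (opt_exists_compact a n (fun s => K s / s ^ n) al c b); try lra.
      * rewrite Hrad; apply Rbar_le_refl.
      * intros s Hs; apply continuous_div_pow; [lra|].
        destruct (Rle_lt_or_eq_dec s b) as [Hsb| ->]; [lra| |].
        -- apply (continuous_ext_loc _ (M1 a)).
           ++ generalize (open_lt b s Hsb); apply filter_imp; intros y Hy.
              unfold K; destruct (Rlt_dec y b); tauto.
           ++ apply (continuous_M1 a k); auto; [lra | rewrite Hrad; exact Hsb].
        -- apply filterlim_locally; intros eps.
           apply filterlim_locally with (eps := eps) in Hlim.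
           unfold K at 1; destruct (Rlt_dec b b); [lra|].
           unfold at_left, within in Hlim; revert Hlim; apply filter_imp; intros y Hy.
           unfold K; destruct (Rlt_dec y b); [auto | apply ball_center].
      * intros s Hs; unfold K; destruct (Rlt_dec s b).
        -- apply obj_interior; rewrite Hrad; assumption.
        -- replace s with b by lra; apply obj_boundary_finite; auto.
      * intros s Hs HsR [Hsa|Hsb]; [apply Hout0; auto|].
        rewrite Hrad in HsR; simpl in HsR; lra.
    (* As s^n <= b^n, this threshold pushes the objective near [b] above its value [v] at [c], so
       the compact interval may stop short of [b]. *)
    + assert (Hbig : at_left b (fun y => v * b ^ n < M1 a y)).
      { apply (Hlim (fun u => v * b ^ n < u)); exists (v * b ^ n); auto. }
      destruct Hbig as [del Hdel].
      assert (Hdp := cond_pos del).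
      set (be := Rmax c (b - del / 2)).
      assert (Hbe : c <= be < b /\ b - del / 2 <= be).
      { unfold be; repeat split; [apply Rmax_l | apply Rmax_lub_lt; lra | apply Rmax_r]. }
      apply (opt_exists_compact a n (fun x => M1 a x / x ^ n) al c be); try lra.
      * rewrite Hrad; simpl; lra.
      * intros s Hs; apply (Hcont s be); [lra | simpl; lra].
      * intros s Hs; apply (Hcont s be); [lra | simpl; lra].
      * intros s Hs HsR [Hsa|Hsb]; [apply Hout0; auto|].
        rewrite Hrad in HsR; simpl in HsR.
        rewrite (obj_interior a n c) by (rewrite Hrad; exact HcR).
        destruct (Rle_lt_or_eq_dec s b HsR) as [Hsb'| ->].
        2:{ rewrite obj_boundary_infty; auto; exact I. }
        rewrite (obj_interior a n s) by (rewrite Hrad; exact Hsb').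
        assert (Hvs : v * b ^ n < M1 a s).
        { apply Hdel; [|exact Hsb']; change (Rabs (s - b) < del); apply Rabs_lt_between; lra. }
        simpl; fold v; apply (Rmult_lt_reg_r (s ^ n)); [apply pow_lt; auto|].
        unfold Rdiv; rewrite Rmult_assoc, Rinv_l, Rmult_1_r by (apply pow_nonzero; lra).
        eapply Rle_lt_trans; [|exact Hvs].
        apply Rmult_le_compat_l; [|apply pow_incr; lra].
        left; apply Rdiv_lt_0_compat; [|apply pow_lt, Hc].
        apply (M1_pos a k); auto; rewrite Hrad; exact HcR.
  (* On the whole plane, not being a polynomial supplies the coefficient beyond [n] that makes the
     objective large at infinity. *)
  - assert (Hj : exists j, (n < j)%nat /\ a j <> 0%C).
    { apply NNPP; intros Hno; apply Hnp; exists (S n); intros j Hj.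
      apply NNPP; intros Haj; apply Hno; exists j; split; [lia | exact Haj]. }
    destruct Hj as [j [Hnj Haj]].
    destruct (obj_large_near_infty a j n v Haj Hnj) as [be' Hinf].
    set (be := Rmax c be').
    assert (Hbe : c <= be /\ be' <= be) by (split; [apply Rmax_l | apply Rmax_r]).
    apply (opt_exists_compact a n (fun x => M1 a x / x ^ n) al c be); try lra.
    + rewrite Hrad; exact I.
    + intros s Hs; apply (Hcont s be); [lra | exact I].
    + intros s Hs; apply (Hcont s be); [lra | exact I].
    + intros s Hs HsR [Hsa|Hsb]; [apply Hout0; auto|].
      rewrite !obj_interior by (rewrite Hrad; exact I).
      apply Hinf; [lra | rewrite Hrad; exact I].
Qed.

(** * The optimal radii *)

Lemma obj_nonneg (a : nat -> C) (k n : nat) (r : R) : a k <> 0%C -> 0 < r ->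
  Rbar_le r (radius a) -> Rbar_le 0 (obj a n r).
Proof.
  intros Hk Hr HrR.
  destruct (Rbar_le_lt_or_eq_dec _ _ HrR) as [H|H].
  - rewrite obj_interior by exact H; simpl; left; apply Rdiv_lt_0_compat.
    + apply (M1_pos a k); auto.
    + apply pow_lt, Hr.
  - assert (H0 : Rbar_le 0 (M1R a)) by (apply (M1R_nonneg a k Hk); rewrite <- H; exact Hr).
    destruct (M1R a) as [L| |] eqn:HL; [| |simpl in H0; tauto].
    + rewrite (obj_boundary_finite a n r L) by auto; simpl in H0 |- *.
      apply Rmult_le_pos; auto; left; apply Rinv_0_lt_compat, pow_lt, Hr.
    + rewrite obj_boundary_infty; auto; exact I.
Qed.

(** An interior competitor has a finite objective; in particular a minimizer on the boundary forces
    [M1R] to be finite. *)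
Lemma opt_obj_finite (a : nat -> C) (k n : nat) (r s : R) : a k <> 0%C ->
  is_opt_radius a n r -> 0 < s -> Rbar_lt s (radius a) ->
  exists v, obj a n r = Finite v /\ v <= M1 a s / s ^ n.
Proof.
  intros Hk [Hr [HrR [Hmin _]]] Hs HsR.
  assert (H := Hmin s Hs (Rbar_lt_le _ _ HsR)); rewrite (obj_interior a n s HsR) in H.
  assert (H0 := obj_nonneg a k n r Hk Hr HrR).
  destruct (obj a n r) as [v| |]; simpl in H, H0; try tauto.
  exists v; auto.
Qed.

Lemma obj_S (a : nat -> C) (n : nat) (r v : R) : 0 < r -> Rbar_le r (radius a) ->
  obj a n r = Finite v -> obj a (S n) r = Finite (v / r).
Proof.
  intros Hr HrR Hv.
  assert (Hrn : r ^ n <> 0) by (apply pow_nonzero; lra).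
  destruct (Rbar_le_lt_or_eq_dec _ _ HrR) as [H|H].
  - rewrite obj_interior in Hv by exact H; injection Hv; intros <-.
    rewrite obj_interior by exact H.
    f_equal; simpl; field; repeat split; auto; lra.
  - destruct (M1R a) as [L| |] eqn:HL.
    + rewrite (obj_boundary_finite a _ r L) in Hv by auto; injection Hv; intros <-.
      rewrite (obj_boundary_finite a _ r L) by auto.
      f_equal; simpl; field; repeat split; auto; lra.
    + rewrite obj_boundary_infty in Hv by auto; discriminate.
    + rewrite (obj_boundary a n r), HL in Hv by auto.
      exfalso; revert Hv; rewrite (is_Rbar_mult_unique (/ r ^ n) m_infty m_infty); [discriminate|].
      apply is_Rbar_mult_sym, is_Rbar_mult_m_infty_pos; simpl.
      apply Rinv_0_lt_compat, pow_lt, Hr.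
Qed.

(* If [s = r_*(n+1) < r = r_*(n)], then [obj n s > obj n r], and dividing by [s < r]
   contradicts the minimality of [s] for [n + 1]. *)
Lemma opt_radius_le_S (a : nat -> C) (k n : nat) (r s : R) : a k <> 0%C ->
  is_opt_radius a n r -> is_opt_radius a (S n) s -> r <= s.
Proof.
  intros Hk Hr Hs; apply Rnot_lt_le; intros Hsr.
  assert (Hs0 : 0 < s) by apply Hs.
  assert (HrR : Rbar_le r (radius a)) by apply Hr.
  assert (HsR : Rbar_lt s (radius a)) by (apply (Rbar_lt_le_trans _ r); auto).
  destruct (opt_obj_finite a k n r s Hk Hr Hs0 HsR) as [v [Hv Hvs]].
  destruct Hr as [Hr0 [_ [Hmin Hsm]]]; destruct Hs as [_ [_ [Hmin' _]]].
  (* A tie at s < r would contradict that [r] is the smallest minimizer for [n]; this is where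
     strictness comes from. *)
  assert (Hne : v <> M1 a s / s ^ n).
  { intros Heq; apply (Rlt_not_le _ _ Hsr), (Hsm s); auto; [apply Rbar_lt_le, HsR|].
    rewrite Hv, obj_interior, Heq; auto. }
  assert (HvO : 0 <= v).
  { generalize (obj_nonneg a k n r Hk Hr0 HrR); rewrite Hv; auto. }
  generalize (Hmin' r Hr0 HrR).
  rewrite (obj_S a n r v Hr0 HrR Hv), (obj_S a n s (M1 a s / s ^ n) Hs0 (Rbar_lt_le _ _ HsR))
    by (apply obj_interior, HsR).
  simpl; apply Rlt_not_le.
  assert (Hi : / r < / s) by (apply Rinv_lt_contravar; nra).
  assert (0 < / r) by (apply Rinv_0_lt_compat; lra).
  unfold Rdiv at 1 2; apply Rle_lt_trans with (v * / s).
  - apply Rmult_le_compat_l; lra.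
  - apply Rmult_lt_compat_r; lra.
Qed.

(** For rho0 <= r <= rho the objective is at least A rho^(-n), whereas at a fixed s > rho it is
    M1(s) s^(-n), smaller by a factor of order (rho/s)^n. The floor [rho0] makes A independent of
    n. *)
Lemma opt_radius_lower (a : nat -> C) (k : nat) (rho0 rho : R) : a k <> 0%C ->
  0 < rho0 -> 0 < rho -> Rbar_lt rho (radius a) ->
  eventually (fun n => forall r, is_opt_radius a n r -> rho0 <= r -> rho < r).
Proof.
  intros Hk H0 Hrho HrhoR.
  destruct (Rbar_lt_between rho _ HrhoR) as [s [Hs HsR]].
  set (A := Cmod (a k) * rho0 ^ k).
  assert (HA : 0 < A) by (apply Rmult_lt_0_compat; [apply Cmod_gt_0, Hk | apply pow_lt, H0]).
  (* The added 1 turns A (s/rho)^n >= M1(s) + A into a strict contradiction with minimality. *)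
  destruct (Pow_x_infinity (s / rho)) with (b := M1 a s / A + 1) as [N HN].
  { rewrite Rabs_pos_eq by (apply Rlt_le, Rdiv_lt_0_compat; lra).
    apply (Rmult_lt_reg_r rho); [lra|]; unfold Rdiv; rewrite Rmult_assoc, Rinv_l; lra. }
  exists N; intros n Hn r Hr Hr0; apply Rnot_le_lt; intros Hrr.
  specialize (HN n Hn).
  rewrite Rabs_pos_eq in HN by (apply pow_le, Rlt_le, Rdiv_lt_0_compat; lra).
  assert (HrR : Rbar_lt r (radius a)) by (apply (Rbar_le_lt_trans _ rho); auto).
  destruct (opt_obj_finite a k n r s Hk Hr) as [v [Hv Hvs]]; [lra | auto |].
  rewrite (obj_interior a n r HrR) in Hv; injection Hv; intros <-.
  assert (HAr : A <= M1 a r).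
  { eapply Rle_trans; [|apply (coef_le_M1 a r k); auto; lra].
    apply Rmult_le_compat_l; [apply Cmod_ge_0 | apply pow_incr; lra]. }
  assert (Hsn : 0 < s ^ n) by (apply pow_lt; lra).
  assert (Hrn : 0 < r ^ n) by (apply pow_lt; lra).
  assert (Hrhon : 0 < rho ^ n) by (apply pow_lt; lra).
  assert (Hrle : r ^ n <= rho ^ n) by (apply pow_incr; lra).
  assert (Hq : A * (s / rho) ^ n <= M1 a s).
  { unfold Rdiv; rewrite Rpow_mult_distr, pow_inv.
    apply (Rmult_le_reg_r (rho ^ n)); auto.
    replace (A * (s ^ n * / rho ^ n) * rho ^ n) with (A * s ^ n) by (field; lra).
    apply Rle_trans with (M1 a s * r ^ n).
    - apply Rle_trans with (M1 a r * s ^ n); [apply Rmult_le_compat_r; lra|].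
      apply (Rmult_le_compat_r (r ^ n * s ^ n)) in Hvs; [|nra].
      replace (M1 a r / r ^ n * (r ^ n * s ^ n)) with (M1 a r * s ^ n) in Hvs by (field; lra).
      replace (M1 a s / s ^ n * (r ^ n * s ^ n)) with (M1 a s * r ^ n) in Hvs by (field; lra).
      exact Hvs.
    - apply Rmult_le_compat_l; [|exact Hrle].
      left; apply (M1_pos a k); auto; lra. }
  apply Rge_le, (Rmult_le_compat_l A) in HN; [|lra].
  replace (A * (M1 a s / A + 1)) with (M1 a s + A) in HN by (field; lra).
  lra.
Qed.

(** * Slopes of [ln M1] and minimality at the boundary *)

Lemma pow_exp_ln (x : R) (n : nat) : 0 < x -> x ^ n = exp (INR n * ln x).
Proof. intros Hx; rewrite <- Rpower_pow by exact Hx; reflexivity. Qed.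

(** The exponential is (y/x)^q: a slope in logarithmic coordinates is a power-law growth rate. *)
Lemma M1_le_of_slope (a : nat -> C) (k : nat) (x y q : R) : a k <> 0%C ->
  0 < x -> x < y -> Rbar_lt y (radius a) ->
  (ln_slope (fun r => ln (M1 a r)) x y <= q -> M1 a y <= M1 a x * exp (q * (ln y - ln x))) /\
  (q <= ln_slope (fun r => ln (M1 a r)) x y -> M1 a x * exp (q * (ln y - ln x)) <= M1 a y).
Proof.
  intros Hk Hx Hxy Hy.
  assert (Hln := ln_increasing x y Hx Hxy).
  assert (HMy : 0 < M1 a y) by (apply (M1_pos a k); auto; lra).
  assert (HMx : 0 < M1 a x)
    by (apply (M1_pos a k); auto; apply (Rbar_lt_trans _ y); auto).
  assert (He := ln_slope_spec (fun r => ln (M1 a r)) x y Hx Hxy); simpl in He.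
  set (p := ln_slope _ x y) in *.
  replace (M1 a y) with (M1 a x * exp (p * (ln y - ln x))).
  - split; intros H; apply Rmult_le_compat_l; try lra; apply exp_le_compat;
      apply Rmult_le_compat_r; lra.
  - rewrite <- He; unfold Rminus; rewrite exp_plus, exp_Ropp, !exp_ln by auto; field; lra.
Qed.

Lemma continuous_exp_ln (c q x b : R) : 0 < b ->
  continuous (fun y => c * exp (q * (ln y - ln x))) b.
Proof. intros Hb; apply @ex_derive_continuous; auto_derive; auto. Qed.

Lemma exp_ln_pow_quot (x b : R) (n : nat) : 0 < x -> 0 < b ->
  exp (INR n * (ln b - ln x)) = b ^ n / x ^ n.
Proof.
  intros Hx Hb; rewrite !pow_exp_ln by auto.
  rewrite Rmult_minus_distr_l; unfold Rminus; rewrite exp_plus, exp_Ropp; reflexivity.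
Qed.

(** A chord of slope q > n forces growth at least (z/y)^q for all z beyond [y]. In the limit [M1R]
    exceeds M1(y) (b/y)^n, so [y] would beat [b]. *)
Lemma ln_slope_le_at_boundary_opt (a : nat -> C) (k n : nat) (b x y : R) : a k <> 0%C ->
  radius a = Finite b -> is_opt_radius a n b -> 0 < x -> x < y -> y < b ->
  ln_slope (fun r => ln (M1 a r)) x y <= INR n.
Proof.
  intros Hk Hrad Hopt Hx Hxy Hyb.
  assert (HyR : Rbar_lt y (radius a)) by (rewrite Hrad; exact Hyb).
  destruct (opt_obj_finite a k n b y Hk Hopt) as [v [Hv Hvy]]; [lra | auto |].
  set (q := ln_slope _ x y); apply Rnot_lt_le; intros Hq.
  assert (Hb : 0 < b) by lra.
  assert (HL : Rbar_le (M1 a y * exp (q * (ln b - ln y))) (M1R a)).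
  { apply (at_left_le (M1 a) (fun z => M1 a y * exp (q * (ln z - ln y))) (M1R a) y b Hyb).
    - apply (filterlim_M1_M1R a k); auto.
    - apply continuous_exp_ln, Hb.
    - intros z Hz.
      assert (HzR : Rbar_lt z (radius a)) by (rewrite Hrad; apply Hz).
      apply (M1_le_of_slope a k y z q); auto; try lra.
      assert (Hc := ln_convex_ln_M1 a k Hk x y z Hx Hxy (proj1 Hz) HzR).
      unfold q; lra. }
  destruct (M1R a) as [L| |] eqn:HLe; simpl in HL; [| |tauto].
  2:{ rewrite obj_boundary_infty in Hv by auto; discriminate. }
  rewrite (obj_boundary_finite a n b L) in Hv by auto; injection Hv; intros <-.
  assert (HMy : 0 < M1 a y) by (apply (M1_pos a k); auto; lra).
  assert (Hlt : M1 a y * exp (INR n * (ln b - ln y)) < M1 a y * exp (q * (ln b - ln y))).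
  { apply Rmult_lt_compat_l; auto; apply exp_increasing, Rmult_lt_compat_r; auto.
    generalize (ln_increasing y b); lra. }
  rewrite exp_ln_pow_quot in Hlt by lra.
  assert (Hbn : 0 < b ^ n) by (apply pow_lt; lra).
  assert (Hyn : 0 < y ^ n) by (apply pow_lt; lra).
  apply (Rmult_le_compat_r (b ^ n)) in Hvy; [|lra].
  replace (L / b ^ n * b ^ n) with L in Hvy by (field; lra).
  replace (M1 a y / y ^ n * b ^ n) with (M1 a y * (b ^ n / y ^ n)) in Hvy by (field; lra).
  lra.
Qed.

(** Chords from [r] to points of (r, z) have slopes between those of the two given chords, and the
    limit behind [Derive] inherits these bounds. *)
Lemma Derive_ln_M1_bounds (a : nat -> C) (k : nat) (x r z : R) : a k <> 0%C ->
  0 < x -> x < r -> r < z -> Rbar_lt z (radius a) ->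
  ln_slope (fun t => ln (M1 a t)) x r <= r * Derive (fun t => ln (M1 a t)) r
    <= ln_slope (fun t => ln (M1 a t)) r z.
Proof.
  intros Hk Hx Hxr Hrz HzR.
  assert (Hc := ln_convex_ln_M1 a k Hk).
  apply (Derive_ln_slope_bounds _ r (z - r)); [lra..|].
  intros w Hw.
  assert (HwR : Rbar_lt w (radius a)) by (apply (Rbar_lt_trans _ z); auto; simpl; lra).
  split.
  - destruct (Hc x r w); auto; lra.
  - apply (Hc r w z); auto; lra.
Qed.

(** The logarithmic derivative at [r] is at most the slope of a chord to the right of [r], hence at
    most [n]; so even nu <= n holds. *)
Lemma nu_lt_infty_of_boundary_opt (a : nat -> C) (k n : nat) (b : R) : a k <> 0%C ->
  radius a = Finite b -> is_opt_radius a n b -> Rbar_lt (nu a) p_infty.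
Proof.
  intros Hk Hrad Hopt.
  apply (Rbar_le_lt_trans _ (INR n)); [|exact I].
  apply (Lub_Rbar_correct _); intros v [r [Hr [HrR ->]]].
  rewrite Hrad in HrR; simpl in HrR |- *.
  eapply Rle_trans.
  - apply (Derive_ln_M1_bounds a k (r / 2) r ((r + b) / 2)); auto; try lra.
    rewrite Hrad; simpl; lra.
  - apply (ln_slope_le_at_boundary_opt a k n b); auto; lra.
Qed.

(** If r < b, all chords starting at [r] have slope at most nu = q < n, so [M1R] is at most M1(r)
    (b/r)^q, which is less than M1(r) (b/r)^n, and [b] would beat [r]. *)
Lemma boundary_opt_of_nu_lt (a : nat -> C) (k n : nat) (b r : R) : a k <> 0%C ->
  radius a = Finite b -> Rbar_lt (M1R a) p_infty -> Rbar_lt (nu a) (INR n) ->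
  is_opt_radius a n r -> r = b.
Proof.
  intros Hk Hrad HM Hnu Hopt.
  destruct (Hopt) as [Hr [HrR [Hmin _]]].
  rewrite Hrad in HrR; simpl in HrR.
  destruct HrR as [Hrb|]; [exfalso | assumption].
  assert (HrR : Rbar_lt r (radius a)) by (rewrite Hrad; exact Hrb).
  assert (Hslope : forall y, r < y -> y < b ->
    Rbar_le (ln_slope (fun t => ln (M1 a t)) r y) (nu a)).
  { intros y Hy Hyb.
    apply Rbar_le_trans with (y * Derive (fun t => ln (M1 a t)) y).
    - apply (Derive_ln_M1_bounds a k r y ((y + b) / 2)); auto; try lra.
      rewrite Hrad; simpl; lra.
    - apply (Lub_Rbar_correct _); exists y; repeat split; [lra|].
      rewrite Hrad; exact Hyb. }
  (* The value +oo contradicts nu < n, and -oo cannot bound the real slopes from above. *)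
  destruct (nu a) as [q| |] eqn:Hq.
  2: simpl in Hnu; tauto.
  2: apply (Hslope ((r + b) / 2)); lra.
  simpl in Hnu.
  assert (Hb : 0 < b) by lra.
  assert (HL : Rbar_le (M1R a) (M1 a r * exp (q * (ln b - ln r)))).
  { apply (at_left_le (M1 a) (fun z => M1 a r * exp (q * (ln z - ln r))) (M1R a) r b Hrb).
    - apply (filterlim_M1_M1R a k); auto.
    - apply continuous_exp_ln, Hb.
    - intros z Hz; apply (M1_le_of_slope a k r z q); auto; try tauto.
      + rewrite Hrad; apply Hz.
      + apply Hslope; tauto. }
  assert (H0 := M1R_nonneg a k Hk); rewrite Hrad in H0; specialize (H0 Hb).
  destruct (M1R a) as [L| |] eqn:HLe; simpl in HL, H0, HM; try tauto.
  assert (H := Hmin b Hb); rewrite Hrad in H; specialize (H (Rbar_le_refl _)).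
  rewrite (obj_interior a n r HrR), (obj_boundary_finite a n b L) in H by auto.
  simpl in H.
  assert (Hlt : M1 a r * exp (q * (ln b - ln r)) < M1 a r * exp (INR n * (ln b - ln r))).
  { apply Rmult_lt_compat_l; [apply (M1_pos a k); auto|].
    apply exp_increasing, Rmult_lt_compat_r; auto.
    generalize (ln_increasing r b); lra. }
  rewrite exp_ln_pow_quot in Hlt by lra.
  assert (Hbn : 0 < b ^ n) by (apply pow_lt; lra).
  assert (Hrn : 0 < r ^ n) by (apply pow_lt; lra).
  apply (Rmult_le_compat_r (b ^ n)) in H; [|lra].
  replace (L / b ^ n * b ^ n) with L in H by (field; lra).
  replace (M1 a r / r ^ n * b ^ n) with (M1 a r * (b ^ n / r ^ n)) in H by (field; lra).
  lra.
Qed.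

Theorem theorem4p6 (a : nat -> C) (n0 : nat)
  (Hnotpoly : ~ (exists N : nat, forall k : nat, (N <= k)%nat -> a k = 0%C))
  (HR : Rbar_lt 0 (radius a))
  (Hn0 : a n0 <> 0%C)
  (Hfirst : forall k : nat, (k < n0)%nat -> a k = 0%C) :
  (forall n : nat, (n0 < n)%nat -> rstar a n <= rstar a (S n)) /\
  is_lim_seq (rstar a) (radius a) /\
  (forall n : nat, (n0 < n)%nat -> Finite (rstar a n) = radius a ->
     is_finite (radius a) /\ Rbar_lt (M1R a) p_infty /\ Rbar_lt (nu a) p_infty) /\
  (forall n : nat, (n0 < n)%nat ->
     is_finite (radius a) -> Rbar_lt (M1R a) p_infty -> Rbar_lt (nu a) (INR n) ->
     Finite (rstar a n) = radius a).
Proof.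
  assert (Hopt : forall n, (n0 < n)%nat -> is_opt_radius a n (rstar a n)).
  { intros n Hn; unfold rstar; apply epsilon_spec, (opt_exists a n0 n); auto. }
  assert (Hmono : forall n, (n0 < n)%nat -> rstar a n <= rstar a (S n)).
  { intros n Hn; apply (opt_radius_le_S a n0 n); auto. }
  split; [exact Hmono|]; split; [|split].
  (* Monotonicity provides the floor, independent of n, that [opt_radius_lower] asks for. *)
  - assert (Hr1 : forall n, (n0 < n)%nat -> rstar a (S n0) <= rstar a n).
    { intros n Hn; induction Hn as [|n Hn IH]; [apply Rle_refl|].
      apply Rle_trans with (1 := IH), Hmono; exact Hn. }
    assert (Hev : forall rho : R, Rbar_lt rho (radius a) -> eventually (fun n => rho < rstar a n)).
    { intros rho Hrho.
      destruct (Rlt_le_dec 0 rho) as [H|H].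
      - assert (H0 : 0 < rstar a (S n0)) by (apply (Hopt (S n0)); lia).
        destruct (opt_radius_lower a n0 (rstar a (S n0)) rho Hn0 H0 H Hrho) as [N HN].
        (* The shift by [S n0] skips the indices for which [rstar] has not been shown to be an
           optimal radius. *)
        exists (N + S n0)%nat; intros n Hn; apply (HN n); [lia | apply Hopt; lia | apply Hr1; lia].
      - exists (S n0); intros n Hn; destruct (Hopt n) as [Hp _]; [lia|lra]. }
    assert (Hup : forall n, (n0 < n)%nat -> Rbar_le (rstar a n) (radius a)) by (intros; apply Hopt; auto).
    apply is_lim_seq_spec; destruct (radius a) as [b| |] eqn:Hrad.
    + intros eps; generalize (cond_pos eps); intros He.
      destruct (Hev (b - eps)) as [N HN]; [simpl; lra|].
      exists (N + S n0)%nat; intros n Hn.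
      assert (b - eps < rstar a n) by (apply HN; lia).
      assert (rstar a n <= b) by (apply Hup; lia).
      apply Rabs_lt_between; lra.
    + intros M; apply Hev; exact I.
    + simpl in HR; tauto.
  - intros n Hn Heq.
    assert (Ho := Hopt n Hn).
    split; [rewrite <- Heq; reflexivity|]; split.
    + destruct (Rbar_lt_between 0 _ HR) as [s [Hs HsR]].
      destruct (opt_obj_finite a n0 n (rstar a n) s Hn0 Ho Hs HsR) as [v [Hv _]].
      assert (H0 := M1R_nonneg a n0 Hn0 HR).
      destruct (M1R a) as [L| |] eqn:HL; [exact I | | exact I].
      rewrite obj_boundary_infty in Hv; auto; [discriminate | apply Ho].
    + apply (nu_lt_infty_of_boundary_opt a n0 n (rstar a n)); auto.
  - intros n Hn Hfin HM Hnu.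
    destruct (radius a) as [b| |] eqn:Hrad; try discriminate.
    f_equal; apply (boundary_opt_of_nu_lt a n0 n); auto.
Qed.
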